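(* Let $\mathbb{P}$ be a radial determinantal point process on $\mathbb{R}^d$ ($d\ge1$) coming from a locally trace class orthogonal projection $\mathcal{K}$ on $L^2(\mathbb{R}^d,dx)$, whose kernel $K$ is normalized so that $K(x,x)=1$ for almost all $x$. Then for any relatively compact open set $\Lambda\subset\mathbb{R}^d$, with $\rho_{R\Lambda}$ the accumulated spectrogram associated to $(\mathcal{K},R\Lambda)$, $$\rho_{R\Lambda}(R\,\cdot)\longrightarrow\mathbf{1}_\Lambda\quad\text{in }L^1(\mathbb{R}^d,dx)\text{ as }R\to+\infty.$$
   Context: Setting. $L^2(\mathbb{R}^d,dx)$ is the complex Hilbert space (Lebesgue measure) with inner product $\langle f,g\rangle=\int f\overline{g}\,dx$. For a bounded Borel set $\Lambda\subset\mathbb{R}^d$, $\mathcal{P}_\Lambda f=\mathbf{1}_\Lambda f$, and $R\Lambda=\{Rx:x\in\Lambda\}$. An operator $\mathcal{K}$ is locally trace class if $\mathcal{P}_\Lambda\mathcal{K}\mathcal{P}_\Lambda$ is trace class for every bounded Borel $\Lambda$; it then has a kernel $K$, i.e. $\mathcal{K}f(x)=\int K(x,y)f(y)\,dy$. If $\mathcal{K}$ is a locally trace class orthogonal projection onto a closed subspace $L$, fix a Borel set $S_0\subset\mathbb{R}^d$ of full Lebesgue measure on which all functions of $L$ are defined pointwise; the kernel and the pointwise values are taken so that, writing $K_x(y)=K(y,x)$, one has $K_x\in L$ and $f(x)=\langle f,K_x\rangle$ for all $f\in L$, $x\in S_0$. In particular $K(x,y)=\overline{K(y,x)}$ and $\int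 K(x,y)K(y,z)\,dy=K(x,z)$ on $S_0$. Radial determinantal point process. The determinantal point process associated to $\mathcal{K}$ is the simple point process on $\mathbb{R}^d$ whose $n$-th correlation function with respect to Lebesgue measure is $\det(K(x_i,x_j))_{i,j=1}^n$ for every $n\ge1$; it is known to exist for every locally trace class orthogonal projection. It is called radial if there is a function $\varphi:[0,+\infty)\to[0,+\infty)$ with $|K(x,y)|^2=\varphi(\|x-y\|)$ for almost all $x,y\in\mathbb{R}^d$, where $\|\cdot\|$ is the Euclidean norm. Accumulated spectrogram. For a bounded Borel set $\Lambda$, let $\mathcal{M}_\Lambda=\mathcal{P}_\Lambda\mathcal{K}\mathcal{P}_\Lambda$, with spectral decomposition $\mathcal{M}_\Lambda f=\sum_{j\ge1}\mu_j^{(\Lambda)}\langle f,\Phi_j^{(\Lambda)}\rangle\Phi_j^{(\Lambda)}$, where $1\ge\mu_1^{(\Lambda)}\ge\mu_2^{(\Lambda)}\ge\dots\ge0$ are the eigenvalues counted with multiplicity and the $\Phi_j^{(\Lambda)}$ are corresponding orthonormal eigenfunctions. Let $\mathcal{N}_\Lambda=\mathcal{K}\mathcal{P}_\Lambda$, with polar decomposition $\mathcal{N}_\Lambda=\mathcal{W}_\Lambda\sqrt{\mathcal{M}_\Lambda}$, where $\mathcal{W}_\Lambda(\sqrt{\mathcal{M}_\Lambda}f)=\mathcal{N}_\Lambda f$ (extended by continuity to the closure of the range) and $\mathcal{W}_\Lambda=0$ on $\ker\mathcal{M}_\Lambda=\ker\mathcal{N}_\Lambda$. Put $\Psi_j^{(\Lambda)}=\mathcal{W}_\Lambda\Phi_j^{(\Lambda)}\in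 L$. Let $N_\Lambda$ be the upper integer part (ceiling) of $\mathrm{Tr}(\mathcal{M}_\Lambda)$. The accumulated spectrogram associated to $(\mathcal{K},\Lambda)$ is $\rho_\Lambda(x)=\sum_{j=1}^{N_\Lambda}|\Psi_j^{(\Lambda)}(x)|^2$, $x\in S_0$. Any fixed choice of eigenfunctions is allowed. *)

(* Defs.v *)
From HB Require Import structures.
From mathcomp Require Import all_boot all_order all_algebra.
From mathcomp Require Import archimedean.
From mathcomp Require Import complex.
From mathcomp Require Import all_classical all_reals all_analysis.
From mathcomp Require Import measurable_realfun.

Set Implicit Arguments.
Unset Strict Implicit.
Unset Printing Implicit Defensive.

Import Order.TTheory GRing.Theory Num.Theory.
Import numFieldNormedType.Exports.

Local Open Scope classical_set_scope.
Local Open Scope ring_scope.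

(* Push-forward along a map with a measurable left inverse, which is what
   keeps it sigma-finite. *)
Section transport.
Context (d1 d2 : measure_display) (T1 : measurableType d1)
  (T2 : measurableType d2) (R : realType).
Variables (m : {measure set T1 -> \bar R}) (m_sf : sigma_finite setT m).
Variables (f : T1 -> T2) (g : T2 -> T1).
Variables (mf : measurable_fun setT f) (mg : measurable_fun setT g).
Variable fK : cancel f g.

Definition transport of sigma_finite setT m & measurable_fun setT f
  & measurable_fun setT g & cancel f g : set T2 -> \bar R := pushforward m f.

Local Notation m' := (transport m_sf mf mg fK).

Let transport0 : m' set0 = 0%E.
Proof. by rewrite /transport /pushforward preimage_set0 measure0. Qed.

Let transport_ge0 A : (0 <= m' A)%E.
Proof. exact: measure_ge0. Qed.

Let transport_sigma_additive : semi_sigma_additive m'.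
Proof.
move=> F mF tF mUF; rewrite /transport /pushforward preimage_bigcup.
apply: measure_semi_sigma_additive.
- by move=> n; rewrite -[X in measurable X]setTI; exact: mf.
- apply/trivIsetP => /= i j _ _ ij; rewrite -preimage_setI.
  by move/trivIsetP : tF => /(_ _ _ _ _ ij) ->//; rewrite preimage_set0.
- by rewrite -preimage_bigcup -[X in measurable X]setTI; exact: mf.
Qed.

HB.instance Definition _ := isMeasure.Build _ _ _ m'
  transport0 transport_ge0 transport_sigma_additive.

Let transport_sigma_finite : sigma_finite setT m'.
Proof.
have [F FT mF] := m_sf.
exists (fun i => g @^-1` F i); first by rewrite -preimage_bigcup -FT.
move=> i; have [mFi Foo] := mF i; split.
  by rewrite -[X in measurable X]setTI; exact: mg.
rewrite /transport /pushforward (_ : _ @^-1` _ = F i)//.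
by apply/seteqP; split => x /=; rewrite fK.
Qed.

HB.instance Definition _ := Measure_isSigmaFinite.Build _ _ _ m'
  transport_sigma_finite.

End transport.

Lemma sigma_finite_product (d1 d2 : measure_display) (T1 : measurableType d1)
    (T2 : measurableType d2) (R : realType)
    (m1 : {sigma_finite_measure set T1 -> \bar R})
    (m2 : {sigma_finite_measure set T2 -> \bar R}) :
  sigma_finite setT (m1 \x m2)%E.
Proof.
have /sigma_finiteP[F [TF ndF Foo]] := sigma_finiteT m1.
have /sigma_finiteP[G [TG ndG Goo]] := sigma_finiteT m2.
exists (fun n => F n `*` G n).
  rewrite -setXTT TF TG predeqE => -[x y]; split.
    move=> [/= [n _ Fnx] [k _ Gky]]; exists (maxn n k) => //; split.
    - by move: x Fnx; exact/subsetPset/ndF/leq_maxl.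
    - by move: y Gky; exact/subsetPset/ndG/leq_maxr.
  by move=> [n _ []/= ? ?]; split; exists n.
move=> k; have [? ?] := Foo k; have [? ?] := Goo k.
split; first exact: measurableX.
by rewrite product_measure1E// lte_mul_pinfty// ge0_fin_numE.
Qed.

Section tuple_measure.
Context (d : measure_display) (T : measurableType d) (R : realType).
Variable mu : {sigma_finite_measure set T -> \bar R}.

Definition tuple_cons n (p : (T * n.-tuple T)%type) : n.+1.-tuple T :=
  [tuple of p.1 :: p.2].

Definition tuple_uncons n (t : n.+1.-tuple T) : (T * n.-tuple T)%type :=
  (thead t, [tuple of behead t]).

Lemma measurable_tuple_cons n : measurable_fun setT (@tuple_cons n).
Proof.
exact: (@measurable_cons _ _ _ _ fst n snd measurable_fst measurable_snd).
Qed.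

Lemma measurable_tuple_uncons n : measurable_fun setT (@tuple_uncons n).
Proof.
apply/measurable_fun_pairP; split; first exact: measurable_tnth.
exact: measurable_behead.
Qed.

Lemma tuple_consK n : cancel (@tuple_cons n) (@tuple_uncons n).
Proof.
by case=> x t; rewrite /tuple_uncons /tuple_cons theadE; congr pair; exact: val_inj.
Qed.

Fixpoint tuple_measure n : {sigma_finite_measure set (n.-tuple T) -> \bar R} :=
  match n with
  | 0 => \d_([tuple])
  | n'.+1 => transport (sigma_finite_product mu (tuple_measure n'))
      (@measurable_tuple_cons n') (@measurable_tuple_uncons n')
      (@tuple_consK n')
  end.

Lemma tuple_measure_box n (A : 'I_n -> set T) :
  (forall i, measurable (A i)) ->
  tuple_measure n [set t | forall i, A i (tnth t i)] = (\prod_i mu (A i))%E.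
Proof.
elim: n A => [|n IH] A mA /=.
  by rewrite big_ord0 diracE mem_set//= => -[].
rewrite /transport /pushforward big_ord_recl -IH// -product_measure1E//.
  congr (_ _); apply/seteqP; split => -[x t] /=.
    move=> h; split => [|i]; first by have := h ord0.
    by have := h (lift ord0 i); rewrite tnthS.
  by move=> [Ax At] i; case: (unliftP ord0 i) => [j|] ->; rewrite ?tnthS.
have -> : [set t : n.-tuple T | forall i, A (lift ord0 i) (tnth t i)] =
    \bigcap_(i in [set: 'I_n]) ((fun t => tnth t i) @^-1` A (lift ord0 i)).
  by apply/seteqP; split => t h i; [move=> _|]; exact: h.
apply: fin_bigcap_measurable => // i _.
by rewrite -[X in measurable X]setTI; exact: measurable_tnth.
Qed.

End tuple_measure.

Section borel_rV.
Context (R : realType) (d : nat).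

Definition borel_rV : set (set 'rV[R]_d) := <<s [set A | open A] >>.

Let borel0 : borel_rV set0.
Proof. exact: sigma_algebra0. Qed.

Let borelC A : borel_rV A -> borel_rV (~` A).
Proof. exact: sigma_algebraC. Qed.

Let borel_bigcup (F : (set 'rV[R]_d)^nat) :
  (forall i, borel_rV (F i)) -> borel_rV (\bigcup_i F i).
Proof. exact: sigma_algebra_bigcup. Qed.

HB.instance Definition _ := isMeasurable.Build
  (sigma_display [set A : set 'rV[R]_d | open A])
  'rV[R]_d borel0 borelC borel_bigcup.

Lemma open_measurable_rV (A : set 'rV[R]_d) : open A -> measurable A.
Proof. by move=> oA; exact: sub_sigma_algebra. Qed.

Definition rV_of_tuple (t : d.-tuple R) : 'rV[R]_d := \row_i tnth t i.

Definition tuple_of_rV (x : 'rV[R]_d) : d.-tuple R := [tuple x ord0 i | i < d].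

Lemma rV_of_tupleK : cancel rV_of_tuple tuple_of_rV.
Proof. by move=> t; apply: eq_from_tnth => i; rewrite tnth_mktuple mxE. Qed.

Lemma measurable_coord_rV (i : 'I_d) :
  measurable_fun setT (fun x : 'rV[R]_d => x ord0 i).
Proof.
apply: (measurability _ (RGenOpens.measurableE R)) => _ [_ [a [b ->]] <-].
rewrite setTI; apply: open_measurable_rV.
by apply: open_comp; [move=> x _; exact: coord_continuous|exact: interval_open].
Qed.

Lemma measurable_tuple_of_rV : measurable_fun setT tuple_of_rV.
Proof.
apply/measurable_fun_tnthP => i; apply: eq_measurable_fun (measurable_coord_rV i).
by move=> x _ /=; rewrite tnth_mktuple.
Qed.

Let box (p : 'rV[rat]_d * nat) : set 'rV[R]_d :=
  [set x | forall i, `|ratr (p.1 ord0 i) - x ord0 i| < p.2.+1%:R^-1].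

Let box_nbhs (x : 'rV[R]_d) (A : set 'rV[R]_d) : nbhs x A ->
  exists2 p, box p x & box p `<=` A.
Proof.
move=> /nbhs_ballP[e /= e0 xA].
have [k ke] : exists k : nat, k.+1%:R^-1 < e / 2.
  have := @near_infty_natSinv_lt R (PosNum (divr_gt0 e0 (@ltr0Sn R 1))).
  by move=> /= [k _ /(_ _ (leqnn k))]; exists k.
have k0 : (0 : R) < k.+1%:R^-1 by rewrite invr_gt0.
have /choice[q qx] (i : 'I_d) : exists q : rat, `|ratr q - x ord0 i| < k.+1%:R^-1.
  have /rat_in_itvoo[q /=] : x ord0 i - k.+1%:R^-1 < x ord0 i + k.+1%:R^-1.
    by rewrite ltrD2l gtrN.
  by rewrite in_itv/= => qx; exists q; rewrite ltr_distl.
exists (\row_i q i, k) => [i /=|y yb]; first by rewrite mxE.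
apply: xA; split => // i j; rewrite (ord1 i) /ball/=.
have := yb j; have := qx j; rewrite /= mxE => xj yj.
rewrite (splitr e) (le_lt_trans (ler_distD (ratr (q j)) _ _))// ltrD//.
  by rewrite distrC (lt_trans xj).
by rewrite (lt_trans yj).
Qed.

Lemma measurable_rV_of_tuple : measurable_fun setT rV_of_tuple.
Proof.
apply: (@measurability _ _ _ _ setT _ [set A : set 'rV[R]_d | open A]) => //.
move=> _ [A oA <-]; rewrite setTI.
have -> : A = \bigcup_(p in [set p | box p `<=` A]) box p.
  apply/seteqP; split => [x Ax|x [p pA] /pA//].
  by have [//|p px pA] := @box_nbhs x A; [exact: open_nbhs_nbhs|exists p].
rewrite preimage_bigcup bigcup_mkcond; apply: countable_bigcupT_measurable => [|p].
  exact: countableP.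
case: ifPn => // _.
rewrite [X in measurable X](_ : _ =
    \bigcap_(i in [set: 'I_d]) ((fun t : d.-tuple R => tnth t i) @^-1`
      [set y | `|ratr (p.1 ord0 i) - y| < p.2.+1%:R^-1])); last first.
  apply/seteqP; split => t /= tp i; first by move=> _; have := tp i; rewrite mxE.
  by rewrite mxE; exact: tp.
apply: fin_bigcap_measurable => // i _.
rewrite -[X in measurable X]setTI; apply: measurable_tnth => //.
rewrite [X in measurable X](_ : _ = ball (ratr (p.1 ord0 i) : R) p.2.+1%:R^-1)//.
exact: measurable_ball.
Qed.

Definition lebesgue_rV : {sigma_finite_measure set 'rV[R]_d -> \bar R} :=
  transport (sigma_finiteT (tuple_measure (@lebesgue_measure R) d))
    measurable_rV_of_tuple measurable_tuple_of_rV rV_of_tupleK.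

Lemma lebesgue_rV_box (a b : 'rV[R]_d) : (forall i, a ord0 i <= b ord0 i) ->
  lebesgue_rV [set x | forall i, a ord0 i <= x ord0 i <= b ord0 i] =
  (\prod_i (b ord0 i - a ord0 i))%:E.
Proof.
move=> ab; rewrite /lebesgue_rV/= /transport /pushforward.
rewrite [X in tuple_measure _ _ X](_ : _ =
    [set t | forall i, `[a ord0 i, b ord0 i]%classic (tnth t i)]); last first.
  by apply/seteqP; split => t /= h i; have := h i; rewrite mxE in_itv.
apply: (etrans (@tuple_measure_box _ _ R (@lebesgue_measure R) d
  (fun i => `[a ord0 i, b ord0 i]%classic) _)) => //.
rewrite -prodEFin; apply: eq_bigr => i _.
apply: (etrans (lebesgue_measure_itv `[a ord0 i, b ord0 i])).
rewrite /= lte_fin; case: ltP => // ba.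
by rewrite (@le_anti _ _ (a ord0 i) (b ord0 i)) ?subrr//; apply/andP.
Qed.

End borel_rV.

(* Elements of L^2(T; C) are represented by functions, equality in L^2 being
   [aeq]; an operator acts on representatives. *)
Section L2.
Context (disp : measure_display) (T : measurableType disp) (R : realType).
Variable mu : {measure set T -> \bar R}.
Local Notation fn := (T -> R[i]).
Implicit Types (f g : fn) (A B S W : fn -> fn) (e : nat -> fn).

Definition abs2 (z : R[i]) : R := complex.Re z ^+ 2 + complex.Im z ^+ 2.

Definition cmeasurable f : Prop :=
  measurable_fun setT (@complex.Re R \o f) /\
  measurable_fun setT (@complex.Im R \o f).

Definition cintegral f : R[i] :=
  Complex (\int[mu]_x complex.Re (f x)) (\int[mu]_x complex.Im (f x)).

Definition L2norm2 f : \bar R := (\int[mu]_x (abs2 (f x))%:E)%E.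

Definition L2 f : Prop := cmeasurable f /\ (L2norm2 f < +oo)%E.

Definition inner f g : R[i] := cintegral (fun x => f x * conjc (g x)).

Definition aeq f g : Prop := {ae mu, forall x, f x = g x}.

Definition L2cvg (u : nat -> fn) f : Prop :=
  (fun n => L2norm2 (fun x => u n x - f x)) @ \oo --> 0%E.

Definition orthonormal e : Prop :=
  (forall k, L2 (e k)) /\ forall j k, inner (e j) (e k) = (j == k)%:R.

(* Bases are indexed by nat: L^2(R^d) is separable and, for d >= 1,
   infinite-dimensional. *)
Definition orthonormal_basis e : Prop :=
  orthonormal e /\
  forall f, L2 f -> L2cvg (fun n x => \sum_(k < n) inner f (e k) * e k x) f.

Definition bounded_operator A : Prop :=
  [/\ forall f, L2 f -> L2 (A f),
      forall f g, L2 f -> L2 g -> aeq f g -> aeq (A f) (A g),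
      forall a f g, L2 f -> L2 g ->
        aeq (A (fun x => a * f x + g x)) (fun x => a * A f x + A g x) &
      exists c : R, forall f, L2 f -> (L2norm2 (A f) <= c%:E * L2norm2 f)%E].

Definition adjoint A B : Prop :=
  forall f g, L2 f -> L2 g -> inner (A f) g = inner f (B g).

(* The order of R[i] makes [0 <= z] say that z is real and nonnegative. *)
Definition positive_operator A : Prop := forall f, L2 f -> 0 <= inner (A f) f.

Definition square_root A S : Prop :=
  [/\ bounded_operator S, positive_operator S &
      forall f, L2 f -> aeq (S (S f)) (A f)].

(* [B] is the adjoint of [A] and [S] is |A|. *)
Definition trace_class A : Prop :=
  bounded_operator A /\
  exists B S e, [/\ bounded_operator B, adjoint A B, square_root (B \o A) S,
    orthonormal_basis e &
    (\sum_(0 <= k <oo) (complex.Re (inner (S (e k)) (e k)))%:E < +oo)%E].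

(* For a trace class operator the sum does not depend on the basis. *)
Definition is_trace A (t : R[i]) : Prop :=
  exists2 e, orthonormal_basis e &
    (fun n => complex.Re (\sum_(k < n) inner (A (e k)) (e k))) @ \oo
      --> complex.Re t /\
    (fun n => complex.Im (\sum_(k < n) inner (A (e k)) (e k))) @ \oo
      --> complex.Im t.

(* [L] is a set of functions with prescribed pointwise values, so it is not
   required to be stable under [aeq]. *)
Definition closed_subspace (L : set fn) : Prop :=
  [/\ L `<=` L2, L (fun=> 0),
      forall a f g, L f -> L g -> L (fun x => a * f x + g x) &
      forall (u : nat -> fn) f, (forall n, L (u n)) -> L2 f -> L2cvg u f ->
        exists2 g, L g & aeq f g].

Definition orthogonal_projection (L : set fn) A : Prop :=
  closed_subspace L /\
  forall f, L2 f ->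
    L (A f) /\ forall g, L g -> inner (fun x => f x - A f x) g = 0.

Definition integral_kernel A (K : T -> T -> R[i]) : Prop :=
  forall f, L2 f -> {ae mu, forall x, A f x = cintegral (fun y => K x y * f y)}.

Definition reproducing (S0 : set T) (L : set fn) (K : T -> T -> R[i]) : Prop :=
  [/\ measurable S0, mu (~` S0) = 0%E &
      forall x, S0 x -> L (fun y => K y x) /\
        forall f, L f -> f x = inner f (fun y => K y x)].

Definition mult_indic (D : set T) f : fn := fun x => \1_D x * f x.

(* When A has finite rank the sequences are padded with zero eigenvalues. *)
Definition spectral_decomposition A (ev : nat -> R) (Phi : nat -> fn) : Prop :=
  [/\ forall j, 0 <= ev j <= 1, forall i j, (i <= j)%N -> ev j <= ev i,
      orthonormal Phi &
      forall f, L2 f ->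
        L2cvg (fun n x =>
          \sum_(j < n) (ev j)%:C%C * inner f (Phi j) * Phi j x) (A f)].

Definition polar_decomposition A M W : Prop :=
  bounded_operator W /\
  exists S, [/\ square_root M S, forall f, L2 f -> aeq (W (S f)) (A f) &
    forall f, L2 f -> aeq (M f) (fun=> 0) -> aeq (W f) (fun=> 0)].

Definition compress (D : set T) A : fn -> fn :=
  mult_indic D \o A \o mult_indic D.

(* [Psi j] is the element of [L] representing the class of [W (Phi j)]; its
   values are thereby fixed on the set where point evaluation is defined. *)
Definition acc_spectrogram (L : set fn) A (D : set T) (rho : T -> R)
    : Prop :=
  exists (ev : nat -> R) (Phi Psi : nat -> fn) (W : fn -> fn) (t : R) (N : nat),
    [/\ spectral_decomposition (compress D A) ev Phi,
        polar_decomposition (A \o mult_indic D) (compress D A) W,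
        forall j, L (Psi j) /\ aeq (Psi j) (W (Phi j)),
        is_trace (compress D A) t%:C%C /\ N%:Z = Num.ceil t &
        forall x, rho x = \sum_(j < N) abs2 (Psi j x)].

End L2.

Section euclidean.
Context (R : realType) (d : nat).
Local Notation X := 'rV[R]_d.
Implicit Types (K : X -> X -> R[i]).

(* The norm of the library on row vectors is the sup norm. *)
Definition euclidean_norm (x : X) : R := Num.sqrt (\sum_i x ord0 i ^+ 2).

Definition bounded_borel (B : set X) : Prop := measurable B /\ bounded_set B.

Definition locally_trace_class (A : (X -> R[i]) -> (X -> R[i])) : Prop :=
  forall B, bounded_borel B -> trace_class (lebesgue_rV R d) (compress B A).

Definition radial K : Prop :=
  exists2 phi : R -> R, forall t, 0 <= t -> 0 <= phi t &
    {ae (lebesgue_rV R d \x lebesgue_rV R d)%E, forall z,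
      abs2 (K z.1 z.2) = phi (euclidean_norm (z.1 - z.2))}.

Definition dilate (r : R) (B : set X) : set X := [set r *: x | x in B].

Section point_process.
Context (dO : measure_display) (Om : measurableType dO).
Variables (P : probability Om R) (xi : Om -> set X).

Definition simple_point_process : Prop :=
  (forall w B, bounded_borel B -> finite_set (xi w `&` B)) /\
  (forall B, bounded_borel B ->
    measurable_fun setT (fun w => counting (xi w `&` B) : \bar R)).

Definition correlation_function n (rho : n.-tuple X -> R) : Prop :=
  forall f : n.-tuple X -> \bar R,
    measurable_fun setT f -> (forall t, 0 <= f t)%E ->
    (\int[P]_w (\esum_(t in [set t : n.-tuple X |
       uniq t /\ forall i, xi w (tnth t i)]) f t) =
     \int[tuple_measure (lebesgue_rV R d) n]_t (f t * (rho t)%:E))%E.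

(* The determinant is almost everywhere real, the kernel being Hermitian. *)
Definition determinantal_process K : Prop :=
  simple_point_process /\
  forall n, (0 < n)%N ->
    correlation_function (fun t : n.-tuple X =>
      complex.Re (\det (\matrix_(i < n, j < n) K (tnth t i) (tnth t j)))).

End point_process.
End euclidean.

(* Main.v *)
Require Import Defs.
From HB Require Import structures.
From mathcomp Require Import all_boot all_order all_algebra.
From mathcomp Require Import complex.
From mathcomp Require Import all_classical all_reals all_analysis.
From mathcomp Require Import measurable_realfun.
From mathcomp Require Import ring lra.
Import Order.TTheory GRing.Theory Num.Theory.
Import numFieldNormedType.Exports.
Local Open Scope classical_set_scope.
Local Open Scope ring_scope.

(* For D = r Lam put P f = 1_D f and M = P KK P, with eigenvalues mu_j and trace t. Since
   sqrt(mu_j) Psi_j = KK P Phi_j, the nonzero Psi_j are orthonormal in L and carry the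
   mass mu_j on D. Bessel's inequality for the kernel functions K_x gives rho <= K(x,x) = 1,
   so the L^1 distance of rho to 1_D is at most t + N - 2 sum_{j<N} mu_j, using t = |D|.
   As t <= N < t + 1 this is at most 1 + 2 sum_{j>=N} mu_j, and comparing every mu_j with
   mu_N bounds that tail by sum_j mu_j (1 - mu_j), which is at most the mass of |K|^2 between
   D and its complement. Radiality makes |K(x+z,x)|^2 = g(z) independent of x, with
   total mass 1; after rescaling, the mass crossing the boundary of D is
   r^d int g(z) |{u in Lam : u - z/r notin Lam}| dz, and the last integral tends to 0 by
   dominated convergence because Lam is open. *)

Set Implicit Arguments.
Unset Strict Implicit.
Unset Printing Implicit Defensive.

(** * The Hilbert space of square-integrable complex functions *)

(** Two obstacles shape the proof. Nothing makes [K] jointly measurable: only the slices [K(., x)]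
    with x in [S0] are known to lie in L^2, and the radial function [phi] carries no measurability.
    So Fubini is never applied to |K|^2: double integrals are replaced by double series over a
    basis, or by integrals of a profile g read off a single slice of [K]. Moreover [W] and the
    square root of M are given only through their defining relations, and the family [Phi] need not
    be complete, so the eigenvalue relations, the trace and the norms of [Psi] have to be derived.
    With s the sum of the first N eigenvalues, the L^1 bound is t + N - 2 s = (N - t) + 2 (t - s).
    The term N - t comes only from rounding t up; rescaling multiplies it by r^-d, which tends to 0
    because d >= 1. The quantity mu_j (1 - mu_j) is the mass that KK P Phi_j leaves outside D (total
    mu_j, inside mu_j^2), and Bessel's inequality for 1_D K_x, at each x outside D, sums these
    masses. *)

Section complex_facts.
Context {R : realType}.
Implicit Types z w a : R[i].

Lemma abs2_ge0 z : 0 <= abs2 z.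
Proof. by rewrite addr_ge0// sqr_ge0. Qed.

Lemma mulc_conj z : z * conjc z = (abs2 z)%:C%C.
Proof. case: z => x y; rewrite /abs2/=; simpc; congr Complex; ring. Qed.

Lemma abs2M z w : abs2 (z * w) = abs2 z * abs2 w.
Proof. case: z w => [a b] [c d]; rewrite /abs2/=; ring. Qed.

Lemma abs2_conj z : abs2 (conjc z) = abs2 z.
Proof. by case: z => a b; rewrite /abs2/= sqrrN. Qed.

Lemma abs2_real (x : R) : abs2 x%:C%C = x ^+ 2.
Proof. by rewrite /abs2/= expr0n addr0. Qed.

Lemma abs2_eq0 z : abs2 z = 0 -> z = 0.
Proof.
case: z => a b /eqP; rewrite /abs2/= paddr_eq0 ?sqr_ge0// !sqrf_eq0.
by case/andP => /eqP -> /eqP ->.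
Qed.

(** Parallelogram identity: the slack is |az - w|^2. It is what makes L^2 stable under linear
    combinations. *)
Lemma abs2_lin_le a z w : abs2 (a * z + w) <= (abs2 a *+ 2) * abs2 z + abs2 w *+ 2.
Proof.
case: a z w => [a b] [c d] [e f]; rewrite /abs2/= !mulr2n.
have := sqr_ge0 (a * c - b * d - e); have := sqr_ge0 (a * d + b * c - f).
nra.
Qed.

End complex_facts.

Section L2_theory.
Context (disp : measure_display) (T : measurableType disp) (R : realType).
Variable mu : {measure set T -> \bar R}.
Local Notation fn := (T -> R[i]).
Implicit Types (f g h : fn).

Definition cintegrable f : Prop :=
  mu.-integrable setT (EFin \o (@complex.Re R \o f)) /\
  mu.-integrable setT (EFin \o (@complex.Im R \o f)).

Lemma measurable_abs2 f : cmeasurable f -> measurable_fun setT (@abs2 R \o f).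
Proof. by case=> m1 m2; apply: measurable_funD; apply: measurable_funX. Qed.

Lemma cmeasurable_lin a f g : cmeasurable f -> cmeasurable g ->
  cmeasurable (fun x => a * f x + g x).
Proof.
case=> m1 m2 [m3 m4]; case: a => a b; split.
  apply: (@eq_measurable_fun _ _ _ _ _ 
    (fun x => a * complex.Re (f x) - b * complex.Im (f x) + complex.Re (g x))).
    by move=> x _ /=; case: (f x) (g x) => [? ?] [? ?].
  apply: measurable_funD => //; apply: measurable_funB; exact: measurable_funM.
apply: (@eq_measurable_fun _ _ _ _ _ 
  (fun x => a * complex.Im (f x) + b * complex.Re (f x) + complex.Im (g x))).
  by move=> x _ /=; case: (f x) (g x) => [? ?] [? ?].
apply: measurable_funD => //; apply: measurable_funD; exact: measurable_funM.
Qed.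

Lemma L2_abs2_integrable f : L2 mu f ->
  mu.-integrable setT (EFin \o (@abs2 R \o f)).
Proof.
move=> [mf foo]; apply/integrableP; split.
  by apply/measurable_EFinP; exact: measurable_abs2.
under eq_integral do rewrite /= ger0_norm ?abs2_ge0//.
exact: foo.
Qed.

Lemma L2_lin a f g : L2 mu f -> L2 mu g -> L2 mu (fun x => a * f x + g x).
Proof.
move=> Lf Lg; have [mf _] := Lf; have [mg _] := Lg.
have mh := cmeasurable_lin a mf mg; split => //.
have ih : mu.-integrable setT
    (EFin \o (fun x => (abs2 a *+ 2) * abs2 (f x) + 2 * abs2 (g x))).
  rewrite (_ : _ \o _ = (fun x => (abs2 a *+ 2)%:E * (abs2 (f x))%:E + 2%:E * (abs2 (g x))%:E)%E)//.
  by apply: integrableD => //; apply: integrableZl => //; exact: L2_abs2_integrable.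
have : mu.-integrable setT (EFin \o (@abs2 R \o (fun x => a * f x + g x))).
  apply: le_integrable ih => //; first by apply/measurable_EFinP; exact: measurable_abs2.
  move=> x _ /=; rewrite lee_fin !ger0_norm ?abs2_ge0//.
    by rewrite mulr_natl; exact: abs2_lin_le.
  by rewrite addr_ge0// mulr_ge0// ?mulrn_wge0// abs2_ge0.
case/integrableP => _; under eq_integral do rewrite /= ger0_norm ?abs2_ge0//.
exact.
Qed.

Lemma L2_mul_integrable f g : L2 mu f -> L2 mu g ->
  cintegrable (fun x => f x * conjc (g x)).
Proof.
move=> Lf Lg; have [[mf1 mf2] _] := Lf; have [[mg1 mg2] _] := Lg.
(* Both parts of f conj(g) are dominated by |f|^2 + |g|^2, since 2|uv| <= u^2 + v^2. *)
have ih : mu.-integrable setT (EFin \o (fun x => abs2 (f x) + abs2 (g x))).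
  rewrite (_ : _ \o _ = (fun x => (abs2 (f x))%:E + (abs2 (g x))%:E)%E)//.
  by apply: integrableD => //; exact: L2_abs2_integrable.
split; apply: le_integrable ih => //.
- apply/measurable_EFinP.
  apply: (@eq_measurable_fun _ _ _ _ _ 
    (fun x => complex.Re (f x) * complex.Re (g x) + complex.Im (f x) * complex.Im (g x))).
    by move=> x _ /=; case: (f x) (g x) => [? ?] [? ?] /=; rewrite mulrN opprK.
  by apply: measurable_funD; exact: measurable_funM.
- move=> x _ /=; rewrite lee_fin [leRHS]ger0_norm; last by apply: addr_ge0; exact: abs2_ge0.
  case: (f x) (g x) => [a b] [c e] /=; rewrite /abs2/= ler_norml.
  apply/andP; split; have := sqr_ge0 (a - c); have := sqr_ge0 (b - e);
    have := sqr_ge0 (a + c); have := sqr_ge0 (b + e);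
    have := sqr_ge0 a; have := sqr_ge0 b; have := sqr_ge0 c; have := sqr_ge0 e; nra.
- apply/measurable_EFinP.
  apply: (@eq_measurable_fun _ _ _ _ _ 
    (fun x => complex.Im (f x) * complex.Re (g x) - complex.Re (f x) * complex.Im (g x))).
    by move=> x _ /=; case: (f x) (g x) => [? ?] [? ?] /=; rewrite mulrN addrC.
  by apply: measurable_funB; exact: measurable_funM.
- move=> x _ /=; rewrite lee_fin [leRHS]ger0_norm; last by apply: addr_ge0; exact: abs2_ge0.
  case: (f x) (g x) => [a b] [c e] /=; rewrite /abs2/= ler_norml.
  apply/andP; split; have := sqr_ge0 (a - e); have := sqr_ge0 (b - c);
    have := sqr_ge0 (a + e); have := sqr_ge0 (b + c);
    have := sqr_ge0 a; have := sqr_ge0 b; have := sqr_ge0 c; have := sqr_ge0 e; nra.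
Qed.

Lemma integrable_lin (a b : R) (u v : T -> R) :
  mu.-integrable setT (EFin \o u) -> mu.-integrable setT (EFin \o v) ->
  mu.-integrable setT (EFin \o (fun x => a * u x + b * v x)).
Proof.
move=> iu iv; rewrite (_ : _ \o _ = (fun x => a%:E * (u x)%:E + b%:E * (v x)%:E)%E)//.
by apply: integrableD => //; exact: integrableZl.
Qed.

Lemma Rintegral_lin (a b : R) (u v : T -> R) :
  mu.-integrable setT (EFin \o u) -> mu.-integrable setT (EFin \o v) ->
  \int[mu]_x (a * u x + b * v x) = a * \int[mu]_x u x + b * \int[mu]_x v x.
Proof.
move=> iu iv; rewrite RintegralD//.
- by rewrite !RintegralZl.
- by rewrite (_ : _ \o _ = (fun x => a%:E * (u x)%:E)%E)//; exact: integrableZl.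
- by rewrite (_ : _ \o _ = (fun x => b%:E * (v x)%:E)%E)//; exact: integrableZl.
Qed.

Lemma cintegral_lin a f g : cintegrable f -> cintegrable g ->
  cintegral mu (fun x => a * f x + g x) = a * cintegral mu f + cintegral mu g.
Proof.
case=> [f1 f2] [g1 g2]; case: a => a b; rewrite /cintegral.
rewrite [X in Complex X _](_ : _ = \int[mu]_x
    (1 * (a * complex.Re (f x) + (- b) * complex.Im (f x)) +
     1 * complex.Re (g x))); last first.
  by apply: eq_Rintegral => x _; case: (f x) (g x) => [? ?] [? ?] /=; ring.
rewrite [X in Complex _ X](_ : _ = \int[mu]_x
    (1 * (a * complex.Im (f x) + b * complex.Re (f x)) +
     1 * complex.Im (g x))); last first.
  by apply: eq_Rintegral => x _; case: (f x) (g x) => [? ?] [? ?] /=; ring.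
rewrite !Rintegral_lin//; try exact: integrable_lin.
apply/eqP; rewrite eq_complex/=; apply/andP; split; apply/eqP; ring.
Qed.

Lemma inner_lin a f g h : L2 mu f -> L2 mu g -> L2 mu h ->
  inner mu (fun x => a * f x + g x) h = a * inner mu f h + inner mu g h.
Proof.
move=> Lf Lg Lh; rewrite /inner -cintegral_lin; try exact: L2_mul_integrable.
by congr cintegral; apply/funext => x; rewrite mulrDl mulrA.
Qed.

Lemma inner_conj f g : L2 mu f -> L2 mu g -> inner mu g f = conjc (inner mu f g).
Proof.
move=> Lf Lg; have [i1 i2] := L2_mul_integrable Lf Lg.
rewrite /inner /cintegral/=; congr Complex.
  by apply: eq_Rintegral => x _; case: (f x) (g x) => [? ?] [? ?] /=; ring.
transitivity (\int[mu]_x (-1 * complex.Im (f x * conjc (g x)) +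
    0 * complex.Im (f x * conjc (g x)))).
  by apply: eq_Rintegral => x _; case: (f x) (g x) => [? ?] [? ?] /=; ring.
by rewrite Rintegral_lin// mul0r addr0 mulN1r.
Qed.

Lemma aeq_sym f g : aeq mu f g -> aeq mu g f.
Proof. by apply: filterS => x ->. Qed.

Lemma aeq_trans f g h : aeq mu f g -> aeq mu g h -> aeq mu f h.
Proof. by apply: filterS2 => x -> ->. Qed.

Lemma inner_aeq f f' g : L2 mu f -> L2 mu f' -> L2 mu g -> aeq mu f f' ->
  inner mu f g = inner mu f' g.
Proof.
move=> Lf Lf' Lg ff'.
have [/integrableP[m1 _] /integrableP[m2 _]] := L2_mul_integrable Lf Lg.
have [/integrableP[m1' _] /integrableP[m2' _]] := L2_mul_integrable Lf' Lg.
rewrite /inner /cintegral /Rintegral; congr Complex; congr fine;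
  by apply: ae_eq_integral => //; apply: filterS ff' => x /= ->.
Qed.

Lemma inner_aeqr f g g' : L2 mu f -> L2 mu g -> L2 mu g' -> aeq mu g g' ->
  inner mu f g = inner mu f g'.
Proof.
move=> Lf Lg Lg' gg'.
by rewrite (inner_conj Lg Lf) (inner_aeq Lg Lg')// (inner_conj Lg' Lf).
Qed.

(** A real integral sends +oo to 0, so this is the squared norm only for f in L^2; [L2norm2E] is the
    bridge. *)
Definition nrm2 f : R := \int[mu]_x abs2 (f x).

Lemma nrm2_ge0 f : 0 <= nrm2 f.
Proof. by apply: Rintegral_ge0 => x _; exact: abs2_ge0. Qed.

Lemma L2norm2E f : L2 mu f -> L2norm2 mu f = (nrm2 f)%:E.
Proof.
move=> [_ foo]; rewrite /nrm2 /Rintegral fineK// ge0_fin_numE//.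
by apply: integral_ge0 => x _; rewrite lee_fin abs2_ge0.
Qed.

Lemma inner_self f : inner mu f f = (nrm2 f)%:C%C.
Proof.
rewrite /inner /cintegral /nrm2; congr Complex.
  by apply: eq_Rintegral => x _; rewrite mulc_conj.
rewrite (_ : (fun _ => _) = cst 0) ?Rintegral_cst ?mul0r//.
by apply/funext => x; rewrite mulc_conj.
Qed.

Lemma nrm2E f : nrm2 f = complex.Re (inner mu f f).
Proof. by rewrite inner_self. Qed.

Lemma nrm2_aeq f g : L2 mu f -> L2 mu g -> aeq mu f g -> nrm2 f = nrm2 g.
Proof.
by move=> Lf Lg fg; rewrite !nrm2E (inner_aeq Lf Lg)// (inner_aeqr Lg Lf Lg).
Qed.

Lemma nrm2_eq0 f : L2 mu f -> nrm2 f = 0 -> aeq mu f (fun=> 0).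
Proof.
move=> Lf f0; have [mf _] := Lf.
have h0 : (\int[mu]_x `|(EFin \o (@abs2 R \o f)) x| = 0)%E.
  under eq_integral do rewrite /= ger0_norm ?abs2_ge0//.
  by have := L2norm2E Lf; rewrite f0.
have m0 : measurable_fun setT (EFin \o (@abs2 R \o f)).
  by apply/measurable_EFinP; exact: measurable_abs2.
have [/(_ h0) h _] := ae_eq_integral_abs mu measurableT m0.
by apply: filterS h => x /= /(_ I) [] /abs2_eq0.
Qed.

End L2_theory.

(** * Cauchy-Schwarz, Bessel, Parseval, and multiplication by indicators *)

Section hilbert.
Context (disp : measure_display) (T : measurableType disp) (R : realType).
Variable mu : {measure set T -> \bar R}.
Local Notation fn := (T -> R[i]).
Local Notation inner := (inner mu).
Local Notation nrm2 := (nrm2 mu).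
Implicit Types (f g h : fn) (e : nat -> fn) (c : nat -> R[i]).

Lemma L2_0 : L2 mu (fun=> 0).
Proof.
split; first by split; exact: measurable_cst.
rewrite /L2norm2 integral0_eq// => x _.
by rewrite /abs2/= expr0n addr0.
Qed.

Lemma L2_scale a f : L2 mu f -> L2 mu (fun x => a * f x).
Proof.
move=> Lf; have := L2_lin a Lf L2_0; congr (L2 mu).
by apply/funext => x; rewrite addr0.
Qed.

Lemma L2_sub f g : L2 mu f -> L2 mu g -> L2 mu (fun x => f x - g x).
Proof.
move=> Lf Lg; have := L2_lin (-1) Lg Lf; congr (L2 mu).
by apply/funext => x; rewrite mulN1r addrC.
Qed.

Lemma inner0 f : inner (fun=> 0) f = 0.
Proof.
rewrite /Defs.inner /cintegral.
rewrite (_ : (fun x => _ (0 * _)) = cst 0); last by apply/funext => x; rewrite mul0r.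
rewrite (_ : (fun x => _ (0 * _)) = cst 0); last by apply/funext => x; rewrite mul0r.
by rewrite !Rintegral_cst// !mul0r.
Qed.

Lemma inner_scale a f g : L2 mu f -> L2 mu g ->
  inner (fun x => a * f x) g = a * inner f g.
Proof.
move=> Lf Lg; have := inner_lin a Lf L2_0 Lg; rewrite inner0 addr0 => <-.
by congr Defs.inner; apply/funext => x; rewrite addr0.
Qed.

Lemma inner_sub f g h : L2 mu f -> L2 mu g -> L2 mu h ->
  inner (fun x => f x - g x) h = inner f h - inner g h.
Proof.
move=> Lf Lg Lh; have := inner_lin (-1) Lg Lf Lh.
rewrite mulN1r addrC => <-.
by congr Defs.inner; apply/funext => x; rewrite mulN1r addrC.
Qed.

Lemma inner_subr f g h : L2 mu f -> L2 mu g -> L2 mu h ->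
  inner h (fun x => f x - g x) = inner h f - inner h g.
Proof.
move=> Lf Lg Lh; rewrite (inner_conj (L2_sub Lf Lg) Lh) inner_sub//.
by rewrite (inner_conj Lf Lh) (inner_conj Lg Lh) rmorphB.
Qed.

Lemma inner_scaler a f g : L2 mu f -> L2 mu g ->
  inner f (fun x => a * g x) = conjc a * inner f g.
Proof.
move=> Lf Lg; rewrite (inner_conj (L2_scale a Lg) Lf) inner_scale//.
by rewrite (inner_conj Lg Lf) rmorphM.
Qed.

Lemma L2_sum c e n : (forall k, L2 mu (e k)) ->
  L2 mu (fun x => \sum_(k < n) c k * e k x).
Proof.
move=> Le; elim: n => [|n IH].
  by under eq_fun do rewrite big_ord0; exact: L2_0.
by under eq_fun do rewrite big_ord_recr/= addrC; exact: L2_lin.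
Qed.

Lemma inner_sum c e n g : (forall k, L2 mu (e k)) -> L2 mu g ->
  inner (fun x => \sum_(k < n) c k * e k x) g = \sum_(k < n) c k * inner (e k) g.
Proof.
move=> Le Lg; elim: n => [|n IH].
  by under eq_fun do rewrite big_ord0; rewrite inner0 big_ord0.
under eq_fun do rewrite big_ord_recr/= addrC.
by rewrite inner_lin//; [rewrite IH big_ord_recr/= addrC|exact: L2_sum].
Qed.

Lemma nrm2_scale a f : L2 mu f -> nrm2 (fun x => a * f x) = abs2 a * nrm2 f.
Proof.
move=> Lf; rewrite !nrm2E inner_scale ?inner_scaler//; last exact: L2_scale.
by rewrite mulrA mulc_conj inner_self/= mul0r subr0.
Qed.

Lemma nrm2_sub f g : L2 mu f -> L2 mu g ->
  nrm2 (fun x => f x - g x) = nrm2 f + nrm2 g - 2 * complex.Re (inner f g).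
Proof.
move=> Lf Lg; rewrite nrm2E inner_sub ?inner_subr//; last exact: L2_sub.
rewrite !inner_self (inner_conj Lf Lg); case: (inner f g) => a b /=; ring.
Qed.

(** The vector f - s <f,g> g has nonnegative squared norm for every real s, which gives a quadratic
    inequality in s. *)
Lemma cauchy_schwarz f g : L2 mu f -> L2 mu g ->
  abs2 (inner f g) <= nrm2 f * nrm2 g.
Proof.
move=> Lf Lg.
have H (s : R) : 0 <= nrm2 f + s ^+ 2 * abs2 (inner f g) * nrm2 g
    - 2 * (s * abs2 (inner f g)).
  have := nrm2_ge0 mu (fun x => f x - (s%:C%C * inner f g) * g x).
  rewrite nrm2_sub//; last exact: L2_scale.
  rewrite nrm2_scale// inner_scaler// abs2M abs2_real.
  suff -> : complex.Re ((s%:C%C * inner f g)^*%C * inner f g) = s * abs2 (inner f g) by [].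
  by case: (inner f g) => a b; rewrite /abs2/=; ring.
have := nrm2_ge0 mu g; rewrite le_eqVlt => /predU1P[g0|g0].
  rewrite -g0 mulr0 leNgt; apply/negP => a0.
  (* When g has norm 0 the inequality is affine in s; this s would make its right side -1. *)
  have := H ((nrm2 f + 1) / (2 * abs2 (inner f g))); rewrite -g0 mulr0 addr0.
  rewrite (_ : 2 * _ = nrm2 f + 1); first by move: (nrm2 f) => u; lra.
  by field; rewrite gt_eqF.
(* The minimiser of the quadratic. *)
have := H (nrm2 g)^-1.
rewrite (_ : _ - _ = (nrm2 f * nrm2 g - abs2 (inner f g)) / nrm2 g); last first.
  by field; rewrite gt_eqF.
by rewrite pmulr_lge0 ?invr_gt0// subr_ge0.
Qed.

(** The coefficients <f, e_k> are not divided by the squared norms p_k: the sum itself contributes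
    p_k |<f, e_k>|^2 and the cross term -2 |<f, e_k>|^2, whence the factor 2 - p_k. *)
Lemma projection_defect e (p : nat -> R) n f : (forall k, L2 mu (e k)) ->
  (forall j k, inner (e j) (e k) = (p j)%:C%C * (j == k)%:R) -> L2 mu f ->
  nrm2 (fun x => f x - \sum_(k < n) inner f (e k) * e k x) =
  nrm2 f - \sum_(k < n) (2 - p k) * abs2 (inner f (e k)).
Proof.
move=> Le oe Lf.
have LS m := L2_sum (fun k => inner f (e k)) m Le.
have fS : complex.Re (inner f (fun x => \sum_(k < n) inner f (e k) * e k x)) =
    \sum_(k < n) abs2 (inner f (e k)).
  rewrite (inner_conj (LS n) Lf) (inner_sum (fun k => inner f (e k)) n Le Lf).
  rewrite (eq_bigr (fun k : 'I_n => (abs2 (inner f (e k)))%:C%C)); last first.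
    by move=> k _; rewrite (inner_conj Lf (Le k)) mulc_conj.
  by rewrite -rmorph_sum.
have SS : nrm2 (fun x => \sum_(k < n) inner f (e k) * e k x) =
    \sum_(k < n) p k * abs2 (inner f (e k)).
  rewrite nrm2E (inner_sum (fun k => inner f (e k)) n Le (LS n)).
  rewrite (eq_bigr (fun k : 'I_n => (p k * abs2 (inner f (e k)))%:C%C)).
    by rewrite -rmorph_sum.
  move=> k _; rewrite (inner_conj (LS n) (Le k)) (inner_sum (fun k => inner f (e k)) n Le (Le k)).
  rewrite (bigD1 k)//= big1 ?addr0; last first.
    move=> i ik; rewrite oe; case: eqP => [ik'|]; last by rewrite !mulr0.
    by move/eqP: ik; case; exact: val_inj.
  by rewrite oe eqxx mulr1 rmorphM/= mulrA mulc_conj/=; simpc; rewrite mulrC.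
rewrite nrm2_sub// fS SS mulr_sumr -addrA -sumrB; congr (_ + _).
by rewrite -sumrN; apply: eq_bigr => k _; ring.
Qed.

(* The norms [p k] are not all 1: [Psi_j] vanishes when its eigenvalue does. *)
Lemma bessel e (p : nat -> R) n f : (forall k, L2 mu (e k)) ->
  (forall j k, inner (e j) (e k) = (p j)%:C%C * (j == k)%:R) ->
  (forall k, p k <= 1) -> L2 mu f ->
  \sum_(k < n) abs2 (inner f (e k)) <= nrm2 f.
Proof.
move=> Le oe p1 Lf; rewrite -subr_ge0.
apply: (le_trans (nrm2_ge0 mu (fun x => f x - \sum_(k < n) inner f (e k) * e k x))).
rewrite (projection_defect n Le oe Lf) lerD2l lerN2; apply: ler_sum => k _.
by rewrite ler_peMl ?abs2_ge0// lerBrDr -lerBrDl; have := p1 k; lra.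
Qed.

Lemma orthonormal_bessel e n f : Defs.orthonormal mu e -> L2 mu f ->
  \sum_(k < n) abs2 (inner f (e k)) <= nrm2 f.
Proof.
move=> [Le oe]; apply: (bessel n (p := fun=> 1)) => // j k.
by rewrite oe mul1r.
Qed.

Lemma L2cvg_nrm2 (u : nat -> fn) f : (forall n, L2 mu (u n)) -> L2 mu f ->
  L2cvg mu u f -> (fun n => nrm2 (fun x => u n x - f x)) @ \oo --> 0.
Proof.
move=> Lu Lf; rewrite /L2cvg.
rewrite (_ : (fun n => L2norm2 mu _) = EFin \o (fun n => nrm2 (fun x => u n x - f x))).
  by move/fine_cvgP => [_].
by apply/funext => n; rewrite L2norm2E//; exact: L2_sub.
Qed.

Lemma L2cvg_inner (u : nat -> fn) f g : (forall n, L2 mu (u n)) -> L2 mu f ->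
  L2 mu g -> L2cvg mu u f ->
  (fun n => complex.Re (inner (u n) g)) @ \oo --> complex.Re (inner f g).
Proof.
move=> Lu Lf Lg /(L2cvg_nrm2 Lu Lf) uf.
apply/cvgrPdist_lt => eps e0.
(* By Cauchy-Schwarz this tolerance on |u_n - f|^2 suffices; the + 1 covers g of norm 0. *)
have d0 : 0 < eps ^+ 2 / (nrm2 g + 1).
  by rewrite divr_gt0 ?exprn_gt0// ltr_wpDl// nrm2_ge0.
move/cvgrPdist_lt : uf => /(_ _ d0); apply: filterS => n.
rewrite sub0r normrN ger0_norm ?nrm2_ge0// => un.
have ab : abs2 (inner (fun x => u n x - f x) g) < eps ^+ 2.
  apply: (le_lt_trans (cauchy_schwarz (L2_sub (Lu n) Lf) Lg)).
  rewrite ltr_pdivlMr in un; last by rewrite ltr_wpDl// nrm2_ge0.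
  apply: le_lt_trans un; rewrite ler_wpM2l ?nrm2_ge0//; lra.
rewrite inner_sub// in ab; move: ab.
case: (inner (u n) g) => a b; case: (inner f g) => a' b'.
rewrite distrC /abs2 /= => ab.
rewrite ltNge; apply/negP => le_eps.
have := lerXn2r 2 (ltW e0) (normr_ge0 (a - a')) le_eps.
rewrite -normrX ger0_norm ?sqr_ge0//; have := sqr_ge0 (b - b'); lra.
Qed.

(** The n-th partial sum falls short of |f|^2 by exactly the squared error of the n-th expansion,
    which tends to 0 for a basis. *)
Lemma parseval e f : orthonormal_basis mu e -> L2 mu f ->
  (\sum_(0 <= k <oo) (abs2 (inner f (e k)))%:E = (nrm2 f)%:E)%E.
Proof.
move=> [[Le oe] be] Lf.
have Lu n := L2_sum (fun k => inner f (e k)) n Le.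
have := L2cvg_nrm2 Lu Lf (be f Lf) => fu.
apply/cvg_lim => //.
rewrite (_ : (fun n => _) = EFin \o (fun n => nrm2 f -
    nrm2 (fun x => \sum_(k < n) inner f (e k) * e k x - f x))); last first.
  apply/funext => n /=; rewrite big_mkord sumEFin; congr EFin.
  rewrite (_ : (fun x => _ - f x) =
      (fun x => (-1) * (f x - \sum_(k < n) inner f (e k) * e k x))); last first.
    by apply/funext => x; rewrite mulN1r opprB.
  rewrite nrm2_scale; last exact: L2_sub.
  rewrite (projection_defect (p := fun=> 1) n)//; last by move=> j k; rewrite oe mul1r.
  rewrite (_ : abs2 (-1) = 1); last by rewrite /abs2/= oppr0 expr0n addr0 sqrrN expr1n.
  rewrite mul1r opprB addrC subrK; apply: eq_bigr => k _.
  by rewrite (_ : 2 - 1 = 1) ?mul1r//; ring.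
apply: cvg_EFin; first by apply: nearW.
by rewrite -[X in _ --> X]subr0; apply: cvgB => //; exact: cvg_cst.
Qed.

Lemma cmeasurable_mult_indic (D : set T) f : measurable D -> cmeasurable f ->
  cmeasurable (mult_indic D f).
Proof.
move=> mD [m1 m2]; split.
  apply: (@eq_measurable_fun _ _ _ _ _ (fun x => \1_D x * complex.Re (f x))).
    move=> x _ /=; rewrite /mult_indic indicE indicE; case: (x \in D) => /=;
    by rewrite ?mul1r ?mul0r.
  exact: measurable_funM.
apply: (@eq_measurable_fun _ _ _ _ _ (fun x => \1_D x * complex.Im (f x))).
  move=> x _ /=; rewrite /mult_indic indicE indicE; case: (x \in D) => /=;
  by rewrite ?mul1r ?mul0r.
exact: measurable_funM.
Qed.

Lemma L2norm2_mult_indic (D : set T) f : measurable D ->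
  L2norm2 mu (mult_indic D f) = (\int[mu]_(x in D) (abs2 (f x))%:E)%E.
Proof.
move=> mD; rewrite [RHS]integral_mkcond; apply: eq_integral => x _.
rewrite patchE /mult_indic indicE; case: (x \in D) => /=; rewrite ?mul1r ?mul0r//.
by rewrite /abs2/= expr0n addr0.
Qed.

Lemma L2_mult_indic (D : set T) f : measurable D -> L2 mu f ->
  L2 mu (mult_indic D f).
Proof.
move=> mD [mf foo]; split; first exact: cmeasurable_mult_indic.
rewrite L2norm2_mult_indic//; apply: le_lt_trans foo; apply: ge0_subset_integral => //.
  by apply/measurable_EFinP; exact: measurable_abs2.
by move=> x _; rewrite lee_fin abs2_ge0.
Qed.

Lemma inner_mult_indic (D : set T) f g :
  inner (mult_indic D f) g = inner f (mult_indic D g).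
Proof.
congr cintegral; apply/funext => x; rewrite /mult_indic indicE.
by case: (x \in D) => /=; rewrite ?mul1r// !mul0r conjc0 mulr0.
Qed.

End hilbert.

(** * Affine changes of variables in [R^d] *)

Section lebesgue_affine.
Context (R : realType).
Local Notation lam := (@lebesgue_measure R).

Let affine (a b : R) (x : measurableTypeR R) : measurableTypeR R := a * x + b.

Let measurable_affine (a b : R) : measurable_fun setT (affine a b).
Proof. by apply: measurable_funD => //; exact: measurable_funM. Qed.

(** Uniqueness of Lebesgue measure: a times its push-forward along x -> a x + b agrees with it on
    half-open intervals, hence everywhere. *)
Lemma ge0_integral_affine (a b : R) (f : measurableTypeR R -> \bar R) : 0 < a ->
  measurable_fun setT f -> (forall x, 0 <= f x)%E ->
  (\int[lam]_x f (a * x + b)%R = (a^-1)%:E * \int[lam]_x f x)%E.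
Proof.
move=> a0 mf f0.
have a_neq0 : a != 0 by rewrite gt_eqF.
have affineK : cancel (affine a b) (affine a^-1 (- (a^-1 * b))).
  by move=> x; rewrite /affine; field.
pose push := transport (sigma_finiteT lam) (measurable_affine a b)
  (measurable_affine a^-1 (- (a^-1 * b))) affineK.
pose nu := mscale (NngNum (ltW a0)) push.
have lamE A : measurable A -> lam A = nu A.
  apply: lebesgue_measure_unique => _ [[p q]] _ <-.
  have pre : affine a b @^-1` `]p, q]%classic = `](p - b) / a, (q - b) / a]%classic.
    apply/seteqP; split => x /=; rewrite /affine !in_itv/=;
    by rewrite ltr_pdivrMr// ler_pdivlMr// ltrBlDr lerBrDr mulrC.
  transitivity (a%:E * lam `]((p - b) / a)%R, ((q - b) / a)%R]%classic)%E; last by rewrite -pre.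
  rewrite !lebesgue_measure_itv/= !lte_fin ltr_pM2r ?invr_gt0// ltrD2r.
  case: ifPn => _; last by rewrite mule0.
  rewrite -!EFinD -EFinM; congr EFin; field.
  by [].
transitivity (\int[push]_y f y)%E.
  by apply/esym; exact: ge0_integral_pushforward.
rewrite [in RHS](eq_measure_integral nu); last by move=> A mA _; exact: lamE.
by rewrite ge0_integral_mscale// muleA -EFinM/= mulVf ?mul1e.
Qed.

End lebesgue_affine.

Section lebesgue_rV_affine.
Context (R : realType).
Local Notation lam := (@lebesgue_measure R).

Definition affine_tuple n (a : R) (b : 'I_n -> R) (t : n.-tuple (measurableTypeR R)) :
  n.-tuple (measurableTypeR R) := [tuple a * tnth t i + b i | i < n].

Lemma measurable_affine_tuple n a (b : 'I_n -> R) :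
  measurable_fun setT (affine_tuple a b).
Proof.
apply/measurable_fun_tnthP => i.
apply: (@eq_measurable_fun _ _ _ _ _ (fun t : n.-tuple (measurableTypeR R) => a * tnth t i + b i)).
  by move=> x _ /=; rewrite tnth_mktuple.
apply: measurable_funD => //; apply: measurable_funM => //.
exact: measurable_tnth.
Qed.

Lemma ge0_integral_tuple_measureS n (f : n.+1.-tuple (measurableTypeR R) -> \bar R) :
  measurable_fun setT f -> (forall t, 0 <= f t)%E ->
  (\int[tuple_measure lam n.+1]_t f t =
   \int[lam]_x \int[tuple_measure lam n]_t f (tuple_cons (x, t)))%E.
Proof.
move=> mf f0.
transitivity (\int[lam \x tuple_measure lam n]_z f (tuple_cons z))%E.
  by apply: ge0_integral_pushforward => //; exact: measurable_tuple_cons.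
rewrite fubini_tonelli1//.
by apply: measurableT_comp => //; exact: measurable_tuple_cons.
Qed.

(** Tonelli splits off the first coordinate; each coordinate contributes one factor 1/a. *)
Lemma ge0_integral_affine_tuple n (a : R) (b : 'I_n -> R)
  (f : n.-tuple (measurableTypeR R) -> \bar R) : 0 < a ->
  measurable_fun setT f -> (forall t, 0 <= f t)%E ->
  (\int[tuple_measure lam n]_t f (affine_tuple a b t) =
   (a^-1 ^+ n)%:E * \int[tuple_measure lam n]_t f t)%E.
Proof.
move=> a0; elim: n b f => [|n IH] b f mf f0.
  rewrite expr0 mul1e; apply: eq_integral => t _; congr f.
  by rewrite !tuple0; apply/esym; exact: tuple0.
rewrite !ge0_integral_tuple_measureS//; last first.
  by apply: measurableT_comp => //; exact: measurable_affine_tuple.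
have mfc : measurable_fun setT (f \o @tuple_cons _ (measurableTypeR R) n).
  by apply: measurableT_comp => //; exact: measurable_tuple_cons.
pose F x := (\int[tuple_measure lam n]_t f (tuple_cons (x, t)))%E.
have mF : measurable_fun setT F.
  refine (measurable_fun_fubini_tonelli_F (m2 := tuple_measure lam n) _ mfc _).
  by move=> z; exact: f0.
have F0 x : (0 <= F x)%E by exact: integral_ge0.
transitivity (\int[lam]_x ((a^-1 ^+ n)%:E * F (a * x + b ord0)%R))%E.
  apply: eq_integral => x _.
  rewrite -(IH (fun i => b (lift ord0 i)) (fun t => f (tuple_cons (a * x + b ord0, t)))) //.
    apply: eq_integral => t _; congr f; apply: eq_from_tnth => i.
    rewrite tnth_mktuple; case: (unliftP ord0 i) => [j|] ->.
      by rewrite !tnthS tnth_mktuple.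
    by rewrite !tnth0.
  apply: measurableT_comp => //.
  by apply: measurableT_comp; [exact: measurable_tuple_cons|exact: measurable_pair1].
rewrite ge0_integralZl//; last 2 first.
- apply: measurableT_comp => //; apply: measurable_funD => //; exact: measurable_funM.
- by rewrite lee_fin exprn_ge0// invr_ge0 ltW.
by rewrite ge0_integral_affine// muleA -EFinM -exprSr.
Qed.

Variable d : nat.
Local Notation X := 'rV[R]_d.
Local Notation mu := (lebesgue_rV R d).

Lemma measurable_fun_rV (disp : measure_display) (T : measurableType disp)
  (f : T -> X) : (forall i, measurable_fun setT (fun x => f x ord0 i)) ->
  measurable_fun setT f.
Proof.
move=> mf; have -> : f = @rV_of_tuple R d \o (fun x => [tuple f x ord0 i | i < d]).
  apply/funext => x /=; apply/rowP => i; rewrite mxE tnth_mktuple.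
  by [].
apply: measurableT_comp; first exact: measurable_rV_of_tuple.
apply/measurable_fun_tnthP => i; apply: eq_measurable_fun (mf i).
by move=> x _ /=; rewrite tnth_mktuple.
Qed.

Lemma measurable_affine_rV (a : R) (b : X) :
  measurable_fun setT (fun x : X => a *: x + b).
Proof.
apply: measurable_fun_rV => i.
apply: (@eq_measurable_fun _ _ _ _ _ (fun x : X => a * x ord0 i + b ord0 i)).
  by move=> x _; rewrite !mxE.
by apply: measurable_funD => //; apply: measurable_funM => //; exact: measurable_coord_rV.
Qed.

Lemma measurable_translate_rV (b : X) :
  measurable_fun setT (fun x : X => x + b).
Proof.
have := measurable_affine_rV 1 b; apply: eq_measurable_fun => x _.
by rewrite scale1r.
Qed.

Lemma ge0_integral_affine_rV (a : R) (b : X) (f : X -> \bar R) : 0 < a ->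
  measurable_fun setT f -> (forall x, 0 <= f x)%E ->
  (\int[mu]_x f (a *: x + b)%R = (a^-1 ^+ d)%:E * \int[mu]_x f x)%E.
Proof.
move=> a0 mf f0.
have mr := @measurable_rV_of_tuple R d.
transitivity (\int[tuple_measure lam d]_t f (a *: rV_of_tuple t + b)%R)%E.
  apply: ge0_integral_pushforward => //.
  by apply: measurableT_comp => //; exact: measurable_affine_rV.
transitivity ((a^-1 ^+ d)%:E * \int[tuple_measure lam d]_t f (rV_of_tuple t))%E.
  rewrite -(ge0_integral_affine_tuple (fun i => b ord0 i) a0)//.
    apply: eq_integral => t _; congr f; apply/rowP => i.
    by rewrite !mxE tnth_mktuple.
  exact: measurableT_comp.
by congr (_ * _)%E; apply/esym; exact: ge0_integral_pushforward.
Qed.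

Lemma ge0_integral_translate_rV (b : X) (f : X -> \bar R) :
  measurable_fun setT f -> (forall x, 0 <= f x)%E ->
  (\int[mu]_x f (x + b)%R = \int[mu]_x f x)%E.
Proof.
move=> mf f0; have := ge0_integral_affine_rV b (@ltr01 R) mf f0.
rewrite invr1 expr1n mul1e => <-.
by apply: eq_integral => x _; rewrite scale1r.
Qed.

Lemma ae_translate_rV (b : X) (P : X -> Prop) :
  {ae mu, forall x, P x} -> {ae mu, forall x, P (x + b)}.
Proof.
move=> [N [mN N0 PN]].
have mA : measurable ((fun x : X => x + b) @^-1` N).
  by rewrite -[X in measurable X]setTI; exact: measurable_translate_rV.
exists ((fun x : X => x + b) @^-1` N); split => //; last by move=> x /=; exact: PN.
transitivity (\int[mu]_x (\1_N (x + b)%R)%:E)%E.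
  by rewrite (integral_indic mu measurableT mA) setIT.
rewrite (ge0_integral_translate_rV b (f := fun x => (\1_N x)%:E))//; last exact/measurable_EFinP.
by rewrite (integral_indic mu measurableT mN) setIT; exact: N0.
Qed.

Lemma measurable_box (a b : X) :
  measurable [set x : X | forall i, a ord0 i <= x ord0 i <= b ord0 i].
Proof.
rewrite (_ : [set x | _] = \bigcap_(i in [set: 'I_d])
    ((fun x : X => x ord0 i) @^-1` `[a ord0 i, b ord0 i]%classic)).
  apply: fin_bigcap_measurable => // i _.
  by rewrite -[Y in measurable Y]setTI; exact: measurable_coord_rV.
apply/seteqP; split => x /= h i; first by move=> _; have := h i; rewrite /= in_itv.
by have := h i I; rewrite /= in_itv.
Qed.

Lemma bounded_lebesgue_rV_lty (B : set X) : measurable B -> bounded_set B ->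
  (mu B < +oo)%E.
Proof.
move=> mB [M [Mr HM]].
(* [bounded_set] bounds the norm only by numbers strictly above M. *)
pose c := `|M| + 1.
have c0 : 0 <= c by rewrite addr_ge0.
have Bc x : B x -> forall i, `|x ord0 i| <= c.
  move=> Bx i; have := HM c; rewrite ltr_pwDr ?ler_norm//= => /(_ isT x Bx).
  by apply: le_trans; rewrite /Num.norm/= mx_normrE; apply: (le_bigmax _ _ (ord0, i)).
pose box := [set x : X | forall i,
  (const_mx (- c) : X) ord0 i <= x ord0 i <= (const_mx c : X) ord0 i].
have mbox : measurable box := measurable_box _ _.
apply: (@le_lt_trans _ _ (mu box)).
  apply: le_measure; rewrite ?inE// => x Bx i.
  by rewrite !mxE -ler_norml; exact: Bc.
rewrite /box lebesgue_rV_box ?ltry// => i; rewrite !mxE.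
by rewrite (le_trans _ c0)// oppr_le0.
Qed.

End lebesgue_rV_affine.

(** * Concentration operators *)

Section projection.
Context (disp : measure_display) (T : measurableType disp) (R : realType).
Variable mu : {measure set T -> \bar R}.
Local Notation fn := (T -> R[i]).
Local Notation inner := (inner mu).
Local Notation nrm2 := (nrm2 mu).
Variables (L : set fn) (KK : fn -> fn) (K : T -> T -> R[i]) (S0 : set T).
Hypothesis KK_proj : orthogonal_projection mu L KK.
Hypothesis K_repr : reproducing mu S0 L K.
Implicit Types (f g h : fn) (D : set T).

Lemma subspace_L2 f : L f -> L2 mu f.
Proof. by have [[LL2 _ _ _] _] := KK_proj; exact: LL2. Qed.

Lemma projection_in f : L2 mu f -> L (KK f).
Proof. by move=> Lf; have [_ /(_ f Lf)[]] := KK_proj. Qed.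

Lemma projection_L2 f : L2 mu f -> L2 mu (KK f).
Proof. by move=> Lf; apply: subspace_L2; exact: projection_in. Qed.

Lemma projection_inner f g : L2 mu f -> L g -> inner (KK f) g = inner f g.
Proof.
move=> Lf Lg; have [_ /(_ f Lf)[_ /(_ g Lg)]] := KK_proj.
rewrite inner_sub//; [|exact: projection_L2|exact: subspace_L2].
by move/eqP; rewrite subr_eq0 => /eqP.
Qed.

Lemma projection_sym f g : L2 mu f -> L2 mu g ->
  inner (KK f) g = inner f (KK g).
Proof.
move=> Lf Lg; have LKf := projection_L2 Lf; have LKg := projection_L2 Lg.
rewrite (inner_conj Lg LKf) -(projection_inner Lg (projection_in Lf)).
by rewrite -(inner_conj LKg LKf) (projection_inner Lf (projection_in Lg)).
Qed.

Lemma kernel_L2 x : S0 x -> L2 mu (fun y => K y x).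
Proof. by move=> Sx; have [_ _ /(_ x Sx)[/subspace_L2]] := K_repr. Qed.

Lemma reproducing_eval f x : L f -> S0 x -> f x = inner f (fun y => K y x).
Proof. by move=> Lf Sx; have [_ _ /(_ x Sx)[_ ]] := K_repr; exact. Qed.

Lemma projection_eval f x : L2 mu f -> S0 x ->
  KK f x = inner f (fun y => K y x).
Proof.
move=> Lf Sx; rewrite (reproducing_eval (projection_in Lf) Sx).
by apply: projection_inner => //; have [_ _ /(_ x Sx)[]] := K_repr.
Qed.

Lemma kernel_nrm2 x : S0 x -> nrm2 (fun y => K y x) = complex.Re (K x x).
Proof.
move=> Sx; rewrite nrm2E -(reproducing_eval _ Sx)//.
by have [_ _ /(_ x Sx)[]] := K_repr.
Qed.

Lemma ae_evaluation_set : {ae mu, forall x, S0 x}.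
Proof.
by have [mS S00 _] := K_repr; exists (~` S0); split => //; exact: measurableC.
Qed.

Lemma compress_L2 D f : measurable D -> L2 mu f -> L2 mu (compress D KK f).
Proof.
by move=> mD Lf; apply: L2_mult_indic => //; apply: projection_L2; exact: L2_mult_indic.
Qed.

(** M = N* N for N = KK P_D, because KK is symmetric and idempotent. Inner products with M thus
    become inner products of functions of [L]. *)
Lemma compress_inner D f g : measurable D -> L2 mu f -> L2 mu g ->
  inner (compress D KK f) g = inner (KK (mult_indic D f)) (KK (mult_indic D g)).
Proof.
move=> mD Lf Lg; have Df := L2_mult_indic mD Lf; have Dg := L2_mult_indic mD Lg.
rewrite /compress /= inner_mult_indic projection_sym//.
by rewrite (projection_inner Df (projection_in Dg)).
Qed.

Lemma compress_nrm2 D f : measurable D -> L2 mu f ->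
  complex.Re (inner (compress D KK f) f) = nrm2 (KK (mult_indic D f)).
Proof. by move=> mD Lf; rewrite compress_inner// inner_self. Qed.

(** The diagonal entries of M are squared norms, so its trace becomes a series of nonnegative terms,
    which may be rearranged freely. *)
Lemma trace_compress_series D t e : measurable D -> Defs.orthonormal_basis mu e ->
  (fun n => complex.Re (\sum_(k < n) inner (compress D KK (e k)) (e k))) @ \oo
      --> t ->
  (\sum_(0 <= k <oo) (nrm2 (KK (mult_indic D (e k))))%:E = t%:E)%E.
Proof.
move=> mD [[Le _] _] te; apply/cvg_lim => //.
rewrite (_ : (fun n => _) = EFin \o
    (fun n => complex.Re (\sum_(k < n) inner (compress D KK (e k)) (e k)))).
  by apply: cvg_EFin => //; exact: nearW.
apply/funext => n /=; rewrite big_mkord sumEFin; congr EFin.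
rewrite raddf_sum; apply: eq_bigr => k _; exact/esym/compress_nrm2.
Qed.

(* The trace is computed without Fubini: the Hilbert-Schmidt norm of [KK P_D]
   is that of its adjoint [P_D KK], whose entries are kernel evaluations. *)
Lemma trace_compress_measure D (t : R) : measurable D ->
  {ae mu, forall x, K x x = 1} ->
  is_trace mu (compress D KK) t%:C%C -> t%:E = mu D.
Proof.
move=> mD K1 [e be [te _]]; have [[Le oe] _] := be.
rewrite -(trace_compress_series mD be te).
have LDe k := L2_mult_indic mD (Le k).
have LKe k := projection_L2 (Le k).
have swap k j : abs2 (inner (KK (mult_indic D (e k))) (e j)) =
    abs2 (inner (mult_indic D (KK (e j))) (e k)).
  rewrite projection_sym// inner_mult_indic.
  by rewrite (inner_conj (L2_mult_indic mD (LKe j)) (Le k)) abs2_conj.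
transitivity (\sum_(0 <= k <oo) \sum_(0 <= j <oo)
    (abs2 (inner (mult_indic D (KK (e j))) (e k)))%:E)%E.
  apply: eq_eseriesr => k _; rewrite -(parseval be); last exact: projection_L2.
  by apply: eq_eseriesr => j _; rewrite swap.
rewrite nneseries_interchange; last by move=> i j; rewrite lee_fin abs2_ge0.
transitivity (\sum_(0 <= j <oo) \int[mu]_(x in D) (abs2 (KK (e j) x))%:E)%E.
  apply: eq_eseriesr => j _; rewrite (parseval be); last exact: L2_mult_indic.
  by rewrite -L2norm2E ?L2norm2_mult_indic//; exact: L2_mult_indic.
have mK j : measurable_fun D (fun x => (abs2 (KK (e j) x))%:E).
  apply/measurable_EFinP; apply: measurable_funTS.
  by have [mKe _] := LKe j; exact: measurable_abs2.
rewrite -integral_nneseries//; last by move=> j x _; rewrite lee_fin abs2_ge0.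
rewrite -[RHS]mul1e -integral_cst//; apply: ge0_ae_eq_integral => //.
- by apply: ge0_emeasurable_sum => // j x _ _; rewrite lee_fin abs2_ge0.
- by move=> x _; apply: nneseries_ge0 => j _ _; rewrite lee_fin abs2_ge0.
- apply: filterS2 ae_evaluation_set K1 => x Sx Kx _.
  (* Parseval for K_x at a fixed point: the values |KK e_j(x)|^2 sum to |K_x|^2 = K(x,x) = 1. *)
  transitivity (\sum_(0 <= j <oo) (abs2 (inner (fun y => K y x) (e j)))%:E)%E.
    apply: eq_eseriesr => j _; rewrite projection_eval//.
    by rewrite (inner_conj (kernel_L2 Sx) (Le j)) abs2_conj.
  by rewrite (parseval be (kernel_L2 Sx)) kernel_nrm2// Kx.
Qed.

(** * Eigenvalues and eigenfunctions of the concentration operator *)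

Section spectral.
Variables (D : set T) (mD : measurable D).
Variables (ev : nat -> R) (Phi : nat -> fn).
Hypothesis spec : spectral_decomposition mu (compress D KK) ev Phi.

Let LPhi j : L2 mu (Phi j).
Proof. by have [_ _ [LP _] _] := spec. Qed.

Let oPhi j k : inner (Phi j) (Phi k) = (j == k)%:R.
Proof. by have [_ _ [_ oP] _] := spec. Qed.

Let ev_ge0 j : 0 <= ev j.
Proof. by have [/(_ j)/andP[]] := spec. Qed.

Lemma quadratic_form_series f : L2 mu f ->
  (\sum_(0 <= j <oo) (ev j * abs2 (inner f (Phi j)))%:E =
   (nrm2 (KK (mult_indic D f)))%:E)%E.
Proof.
move=> Lf; have [_ _ _ /(_ f Lf) cv] := spec; apply/cvg_lim => //.
have Lu n := L2_sum (fun j => (ev j)%:C%C * inner f (Phi j)) n LPhi.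
have := L2cvg_inner Lu (compress_L2 mD Lf) Lf cv.
rewrite compress_nrm2// => {}cv.
rewrite (_ : (fun n => _) = EFin \o (fun n => complex.Re (inner
   (fun x => \sum_(j < n) (ev j)%:C%C * inner f (Phi j) * Phi j x) f))).
  by apply: cvg_EFin => //; exact: nearW.
apply/funext => n; rewrite big_mkord sumEFin; apply: (congr1 EFin).
rewrite (inner_sum (fun j => (ev j)%:C%C * inner f (Phi j)) n LPhi Lf).
rewrite raddf_sum; apply: eq_bigr => j _.
rewrite (inner_conj Lf (LPhi j)) -mulrA mulc_conj /=.
by rewrite mulr0 subr0.
Qed.

(** [Phi] is only orthonormal, so the trace is not evaluated in it. Each diagonal entry in the basis
    of the trace is expanded along [Phi]; after exchanging the two sums, Parseval leaves |Phi_j|^2 =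
    1 beside mu_j. *)
Lemma trace_compress_eigenvalues (t : R) : is_trace mu (compress D KK) t%:C%C ->
  (\sum_(0 <= j <oo) (ev j)%:E = t%:E)%E.
Proof.
move=> [e be [te _]]; have [[Le oe] _] := be.
rewrite -(trace_compress_series mD be te).
under [RHS]eq_eseriesr do rewrite -quadratic_form_series//.
rewrite nneseries_interchange; last first.
  by move=> i j; rewrite lee_fin mulr_ge0// abs2_ge0.
apply: eq_eseriesr => j _.
under eq_eseriesr do rewrite EFinM.
rewrite nneseriesZl; last by move=> k _; rewrite lee_fin abs2_ge0.
under eq_eseriesr do rewrite (inner_conj (LPhi j) (Le _)) abs2_conj.
by rewrite (parseval be (LPhi j)) nrm2E oPhi eqxx mule1.
Qed.

Lemma eigenfunction i :
  aeq mu (compress D KK (Phi i)) (fun x => (ev i)%:C%C * Phi i x).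
Proof.
have [_ _ _ /(_ _ (LPhi i)) cv] := spec.
have Lu n := L2_sum (fun j => (ev j)%:C%C * inner (Phi i) (Phi j)) n LPhi.
have LM := compress_L2 mD (LPhi i).
have Le := L2_scale (ev i)%:C%C (LPhi i).
have {cv} := L2cvg_nrm2 Lu LM cv.
have cst0 : (fun n => nrm2 (fun x => \sum_(j < n) (ev j)%:C%C *
     inner (Phi i) (Phi j) * Phi j x - compress D KK (Phi i) x)) @ \oo -->
   nrm2 (fun x => (ev i)%:C%C * Phi i x - compress D KK (Phi i) x).
  (* By orthonormality only the term j = i survives, and it is present as soon as n > i. *)
  apply: cvg_near_cst; exists i.+1 => // n /= ni;
  congr nrm2; apply/funext => x; congr (_ - _).
  rewrite (bigD1 (Ordinal ni))//= oPhi eqxx mulr1 big1 ?addr0// => j ji.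
  rewrite oPhi; case: eqP => [ij|]; last by rewrite mulr0 mul0r.
  by case/eqP: ji; apply: val_inj.
move=> /(cvg_unique _ cst0) n0.
have := nrm2_eq0 (L2_sub Le LM) (n0 (@Rhausdorff R)).
by apply: filterS => x /eqP; rewrite subr_eq0 => /eqP ->.
Qed.

Lemma projected_inner i j :
  inner (KK (mult_indic D (Phi i))) (KK (mult_indic D (Phi j))) =
  (ev i)%:C%C * (i == j)%:R.
Proof.
rewrite -compress_inner// (inner_aeq (compress_L2 mD (LPhi i)) _ _ (eigenfunction i))//.
  by rewrite inner_scale// oPhi.
exact: L2_scale.
Qed.

(** Restricted to D, the function KK P Phi_i is M Phi_i = mu_i Phi_i. *)
Lemma projected_nrm2_in i :
  (\int[mu]_(x in D) (abs2 (KK (mult_indic D (Phi i)) x))%:E = (ev i ^+ 2)%:E)%E.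
Proof.
have LK := projection_L2 (L2_mult_indic mD (LPhi i)).
rewrite -L2norm2_mult_indic// L2norm2E; last exact: L2_mult_indic.
have Le := L2_scale (ev i)%:C%C (LPhi i).
have := nrm2_aeq (compress_L2 mD (LPhi i)) Le (eigenfunction i).
by rewrite nrm2_scale// abs2_real (nrm2E mu (Phi i)) oPhi eqxx mulr1 => <-.
Qed.

(** The total mass of KK P Phi_i is <M Phi_i, Phi_i> = mu_i, of which mu_i^2 lies in D. *)
Lemma projected_nrm2_out i :
  (\int[mu]_(x in ~` D) (abs2 (KK (mult_indic D (Phi i)) x))%:E =
   (ev i * (1 - ev i))%:E)%E.
Proof.
have LK := projection_L2 (L2_mult_indic mD (LPhi i)).
have [mK _] := LK.
have mA : measurable_fun setT (fun x => (abs2 (KK (mult_indic D (Phi i)) x))%:E).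
  by apply/measurable_EFinP; exact: measurable_abs2.
have := L2norm2E LK; rewrite nrm2E projected_inner eqxx mulr1/= /L2norm2.
rewrite -(setUv D) ge0_integral_setU//=; last 4 first.
- exact: measurableC.
- by rewrite setUv.
- by move=> x _; rewrite lee_fin abs2_ge0.
- by apply/disj_setPS => x [].
rewrite projected_nrm2_in => H.
rewrite mulrBr mulr1 EFinB -expr2 -H addeAC subee// add0e.
by [].
Qed.

(** * The polar decomposition and the functions [Psi] *)

Section polar.
Variables (W : fn -> fn) (Psi : nat -> fn).
Hypothesis pol : polar_decomposition mu (KK \o mult_indic D) (compress D KK) W.
Hypothesis LPsi : forall j, L (Psi j).
Hypothesis PsiW : forall j, aeq mu (Psi j) (W (Phi j)).

Let Psi0 i : ev i = 0 -> aeq mu (Psi i) (fun=> 0).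
Proof.
move=> e0; have [_ [S [_ _ /(_ _ (LPhi i)) H]]] := pol.
apply: aeq_trans (PsiW i) (H _); apply: filterS (eigenfunction i) => x ->.
by rewrite e0 mul0r.
Qed.

(** [square_root] describes S only by positivity and S^2 = M, so its action on an eigenfunction must
    be found before W S = KK P can be evaluated there. For eigenvalue 0 both sides vanish. *)
Lemma polar_eigenfunction i :
  aeq mu (fun x => (Num.sqrt (ev i))%:C%C * Psi i x) (KK (mult_indic D (Phi i))).
Proof.
have LK := projection_L2 (L2_mult_indic mD (LPhi i)).
have := ev_ge0 i; rewrite le_eqVlt => /predU1P[e0|e0].
  have : nrm2 (KK (mult_indic D (Phi i))) = 0.
    by rewrite nrm2E projected_inner -e0 mul0r.
  move/(nrm2_eq0 LK) => K0; apply: filterS K0 => x ->.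
  by rewrite -e0 sqrtr0 mul0r.
have [[LW Waeq Wlin [c Wc]] [S [[[LS Saeq Slin _] Spos SS] WS _]]] := pol.
set s := Num.sqrt (ev i).
have s0 : 0 < s by rewrite sqrtr_gt0.
have ss : s ^+ 2 = ev i by rewrite sqr_sqrtr// ltW.
have LSP := LS _ (LPhi i).
(* [S v = - s v], so positivity of [S] forces [v = 0], that is
   [S (Phi i) = s * Phi i]. *)
pose v x := (- s%:C%C) * Phi i x + S (Phi i) x.
have Lv : L2 mu v by exact: L2_lin.
have LSv := LS _ Lv.
have Sv : aeq mu (S v) (fun x => (- s%:C%C) * v x).
  apply: aeq_trans (Slin (- s%:C%C) _ _ (LPhi i) LSP) _.
  apply: filterS2 (SS _ (LPhi i)) (eigenfunction i) => x -> ->.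
  by rewrite /v -ss rmorphXn/=; ring.
have v0 : nrm2 v = 0.
  have := Spos _ Lv; rewrite (inner_aeq LSv _ Lv Sv); last exact: L2_scale.
  rewrite inner_scale// inner_self -rmorphN -rmorphM/= (@lecR R 0).
  rewrite mulNr oppr_ge0 pmulr_rle0// => v_le0.
  by apply/eqP; rewrite eq_le v_le0 nrm2_ge0.
have Wv0 : aeq mu (W v) (fun=> 0).
  apply: nrm2_eq0; first exact: LW.
  have := Wc _ Lv; rewrite !L2norm2E//; last exact: LW.
  rewrite v0 mule0 lee_fin => Wv_le0.
  by apply/eqP; rewrite eq_le Wv_le0 nrm2_ge0.
(* Linearity turns [W v = 0] into [W (S (Phi i)) = s * W (Phi i)]. *)
have H := aeq_trans (aeq_sym (Wlin (- s%:C%C) _ _ (LPhi i) LSP)) Wv0.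
apply: filterS3 H (PsiW i) (WS _ (LPhi i)) => x + -> /= <-.
by rewrite mulNr addrC => /eqP; rewrite subr_eq0 => /eqP.
Qed.

(** For positive eigenvalues, [projected_inner] is divided by sqrt(mu_i mu_j); for a zero eigenvalue
    W kills the eigenfunction. The squared norm is thus 1 or 0, in the form that [bessel] takes. *)
Lemma Psi_inner i j : inner (Psi i) (Psi j) =
  ((0 < ev i)%R%:R : R)%:C%C * (i == j)%:R.
Proof.
have LP k := subspace_L2 (LPsi k).
have LK k := projection_L2 (L2_mult_indic mD (LPhi k)).
have := ev_ge0 i; rewrite le_eqVlt => /predU1P[e0|ei0].
  rewrite -e0 ltxx mul0r (inner_aeq (LP i) (L2_0 mu) (LP j)) ?inner0//.
  exact: Psi0.
rewrite ei0 mul1r.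
have := ev_ge0 j; rewrite le_eqVlt => /predU1P[e0|ej0].
  rewrite (inner_aeqr (LP i) (LP j) (L2_0 mu)); last exact: Psi0.
  rewrite (inner_conj (L2_0 mu) (LP i)) inner0 conjc0.
  by case: eqP => // ij; move: ei0; rewrite ij -e0 ltxx.
have := projected_inner i j.
have LsP k := L2_scale (Num.sqrt (ev k))%:C%C (LP k).
rewrite -(inner_aeq (LsP i) (LK i) (LK j) (polar_eigenfunction i)).
rewrite -(inner_aeqr (LsP i) (LsP j) (LK j) (polar_eigenfunction j)).
rewrite inner_scale// inner_scaler// conjc_real mulrA -rmorphM => H.
have sij : (Num.sqrt (ev i) * Num.sqrt (ev j))%:C%C != 0 :> R[i].
  by rewrite fmorph_eq0 mulf_neq0// gt_eqF// sqrtr_gt0.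
apply: (mulfI sij); rewrite H; case: eqP => [->|]; last by rewrite !mulr0.
by rewrite -expr2 sqr_sqrtr.
Qed.

Lemma Psi_nrm2_in i : (\int[mu]_(x in D) (abs2 (Psi i x))%:E = (ev i)%:E)%E.
Proof.
have LP := subspace_L2 (LPsi i); have [mP _] := LP.
have mA : measurable_fun D (fun x => (abs2 (Psi i x))%:E).
  by apply/measurable_EFinP; apply: measurable_funTS; exact: measurable_abs2.
have := ev_ge0 i; rewrite le_eqVlt => /predU1P[e0|ei0].
  rewrite -e0; transitivity (\int[mu]_(x in D) cst 0%E x)%E.
    apply: ge0_ae_eq_integral => //; first by move=> x _; rewrite lee_fin abs2_ge0.
    apply: filterS (Psi0 (esym e0)) => x -> _.
    by rewrite /abs2/= expr0n addr0.
  by rewrite integral0.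
have := projected_nrm2_in i.
have -> : (\int[mu]_(x in D) (abs2 (KK (mult_indic D (Phi i)) x))%:E =
   \int[mu]_(x in D) ((ev i)%:E * (abs2 (Psi i x))%:E))%E.
  apply: ge0_ae_eq_integral => //.
  - apply/measurable_EFinP; apply: measurable_funTS; apply: measurable_abs2.
    by have [] := projection_L2 (L2_mult_indic mD (LPhi i)).
  - exact: measurable_funeM.
  - by move=> x _; rewrite lee_fin abs2_ge0.
  - by move=> x _; rewrite mule_ge0// lee_fin ?abs2_ge0// ltW.
  - apply: filterS (polar_eigenfunction i) => x <- _.
    by rewrite abs2M abs2_real sqr_sqrtr ?EFinM// ltW.
rewrite ge0_integralZl//; last 2 first.
- by move=> x _; rewrite lee_fin abs2_ge0.
- by rewrite lee_fin ltW.
rewrite expr2 EFinM => /(congr1 (fun z => ((ev i)^-1)%:E * z)%E).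
by rewrite !muleA -!EFinM mulVf ?gt_eqF// mul1e mul1r.
Qed.

End polar.
End spectral.
End projection.

(** * The L^1 error for a fixed set D *)

Section spectrogram.
Context (disp : measure_display) (T : measurableType disp) (R : realType).
Local Notation fn := (T -> R[i]).

(** Let a and b be the sums of mu_j over j < N and over N <= j < n. Since mu_j >= mu_N on the first
    range and 1 - mu_j >= 1 - mu_N on the second, the right side is at least mu_N (N - a) + (1 -
    mu_N) b = b + mu_N (N - a - b), and a + b <= N. *)
Lemma tail_le_spread (ev : nat -> R) (N n : nat) :
  (forall j, 0 <= ev j <= 1) -> (forall i j, (i <= j)%N -> ev j <= ev i) ->
  (N <= n)%N -> \sum_(j < n) ev j <= N%:R ->
  \sum_(j < n) ev j - \sum_(j < N) ev j <= \sum_(j < n) ev j * (1 - ev j).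
Proof.
move=> ev01 ev_dec Nn.
rewrite -!(big_mkord xpredT (fun j => ev j)).
rewrite -!(big_mkord xpredT (fun j => ev j * (1 - ev j))).
rewrite !(big_cat_nat (leq0n N) Nn)/= => sN.
set a := \sum_(0 <= j < N) ev j; set b := \sum_(N <= j < n) ev j.
rewrite -/a -/b in sN.
have h1 : ev N * (N%:R - a) <= \sum_(0 <= j < N) ev j * (1 - ev j).
  have -> : N%:R - a = \sum_(0 <= j < N) (1 - ev j).
    by rewrite sumrB sumr_const_nat subn0.
  rewrite mulr_sumr !big_nat; apply: ler_sum => j /andP[_ jN].
  have /andP[ej0 ej1] := ev01 j.
  by rewrite ler_wpM2r ?subr_ge0// ev_dec// ltnW.
have h2 : (1 - ev N) * b <= \sum_(N <= j < n) ev j * (1 - ev j).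
  rewrite mulr_sumr !big_nat; apply: ler_sum => j /andP[Nj _].
  have /andP[ej0 ej1] := ev01 j.
  by rewrite mulrC ler_wpM2l// lerD2l lerN2 ev_dec.
have /andP[eN0 eN1] := ev01 N.
apply: le_trans (lerD h1 h2); rewrite -subr_ge0.
rewrite (_ : _ - _ = ev N * (N%:R - (a + b))); last by ring.
by rewrite mulr_ge0// subr_ge0.
Qed.

Variable mu : {measure set T -> \bar R}.
Local Notation inner := (inner mu).
Local Notation nrm2 := (nrm2 mu).
Variables (L : set fn) (KK : fn -> fn) (K : T -> T -> R[i]) (S0 : set T).
Hypothesis KK_proj : orthogonal_projection mu L KK.
Hypothesis K_repr : reproducing mu S0 L K.
Hypothesis K1 : {ae mu, forall x, K x x = 1}.
Variables (D : set T) (mD : measurable D).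

Lemma acc_spectrogram_bound (rho : T -> R) (G : T -> \bar R) :
  measurable_fun setT G -> (forall x, 0 <= G x)%E ->
  {ae mu, forall x, (nrm2 (mult_indic D (fun y => K y x)))%:E <= G x}%E ->
  acc_spectrogram mu L KK D rho ->
  measurable_fun setT rho /\
  (\int[mu]_x `|rho x - \1_D x|%:E <= 1 + 2%:E * \int[mu]_(x in ~` D) G x)%E.
Proof.
move=> mG G0 KG [ev [Phi [Psi [W [t [N [spec pol LPW [trt tN] rhoE]]]]]]].
have LPsi j : L (Psi j) by have [] := LPW j.
have PsiW j : aeq mu (Psi j) (W (Phi j)) by have [] := LPW j.
have LP j : L2 mu (Psi j) := subspace_L2 KK_proj (LPsi j).
have [ev01 ev_dec [LPhi _] _] := spec.
have mC : measurable (~` D) by exact: measurableC.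
have mAbs j : measurable_fun setT (fun x => abs2 (Psi j x)).
  by have [mP _] := LP j; exact: measurable_abs2.
have mrho : measurable_fun setT rho.
  rewrite (_ : rho = (fun x => \sum_(j < N) abs2 (Psi j x))); last exact/funext.
  exact: measurable_sum.
have rho0 x : 0 <= rho x by rewrite rhoE; apply: sumr_ge0 => j _; exact: abs2_ge0.
split => //.
have muD : t%:E = mu D := trace_compress_measure KK_proj K_repr mD K1 trt.
have evt : (\sum_(0 <= j <oo) (ev j)%:E = t%:E)%E :=
  trace_compress_eigenvalues KK_proj mD spec trt.
have [tN1 tN2] : t <= N%:R /\ N%:R < t + 1.
  have := ceil_itv t; rewrite -tN intrB => /andP[]/=.
  by rewrite ltrBlDr => -> ->.
have sum_le_t n : \sum_(j < n) ev j <= t.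
  rewrite -lee_fin -evt -sumEFin -(big_mkord xpredT (fun j => (ev j)%:E)).
  by apply: nneseries_lim_ge => j _ _; rewrite lee_fin; have /andP[] := ev01 j.
set s := \sum_(j < N) ev j.
have rho_le1 : {ae mu, forall x, rho x <= 1}.
  apply: filterS2 (ae_evaluation_set K_repr) K1 => x Sx Kx.
  have Kn : nrm2 (fun y => K y x) = 1 by rewrite (kernel_nrm2 K_repr Sx) Kx.
  rewrite -[leRHS]Kn.
  have LKx := kernel_L2 KK_proj K_repr Sx.
  apply: le_trans (bessel N LP (Psi_inner KK_proj mD spec pol LPsi PsiW) _ LKx).
    rewrite rhoE; apply: ler_sum => j _.
    by rewrite (reproducing_eval K_repr (LPsi j) Sx) (inner_conj LKx (LP j)) abs2_conj.
  by move=> k; rewrite lern1 leq_b1.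
have int_rho A : measurable A -> (\int[mu]_(x in A) (rho x)%:E =
    \sum_(j < N) \int[mu]_(x in A) (abs2 (Psi j x))%:E)%E.
  move=> mA; rewrite -ge0_integral_sum//.
  - by apply: eq_integral => x _; rewrite sumEFin rhoE.
  - by move=> j; apply/measurable_EFinP; exact: measurable_funTS.
  - by move=> j x _; rewrite lee_fin abs2_ge0.
have rho_in : (\int[mu]_(x in D) (rho x)%:E = s%:E)%E.
  rewrite int_rho// -sumEFin; apply: eq_bigr => j _.
  exact: (Psi_nrm2_in KK_proj mD spec pol LPsi PsiW).
have mrhoE A : measurable_fun A (fun x => (rho x)%:E).
  by apply/measurable_EFinP; exact: measurable_funTS.
have mdiff A : measurable_fun A (fun x => `|rho x - \1_D x|%:E).
  apply/measurable_EFinP; apply: measurable_funTS.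
  apply: measurableT_comp => //.
  by apply: measurable_funB => //; exact: measurable_indic.
have rho_out : (\int[mu]_(x in ~` D) (rho x)%:E <= (N%:R - s)%:E)%E.
  have : (\int[mu]_x (rho x)%:E <= N%:R%:E)%E.
    rewrite int_rho// (_ : N%:R = \sum_(j < N) 1); last by rewrite sumr_const card_ord.
    rewrite -sumEFin; apply: lee_sum => j _.
    have := L2norm2E (LP j).
    rewrite nrm2E (Psi_inner KK_proj mD spec pol LPsi PsiW) eqxx mulr1/= => h.
    by rewrite [leLHS]h lee_fin lern1 leq_b1.
  rewrite -(setUv D) ge0_integral_setU//=.
  - by rewrite rho_in EFinB leeBrDl.
  - by move=> x _; rewrite lee_fin.
  - by apply/disj_setPS => x [].
have diff_in : (\int[mu]_(x in D) `|rho x - \1_D x|%:E = (t - s)%:E)%E.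
  (* On D the two terms add up to 1 because rho <= 1 almost everywhere; adding instead of
     subtracting keeps every integrand nonnegative. *)
  have : (\int[mu]_(x in D) (`|rho x - \1_D x|%:E + (rho x)%:E) = t%:E)%E.
    rewrite muD -[RHS]mul1e -integral_cst//; apply: ge0_ae_eq_integral => //.
    - exact: emeasurable_funD.
    - by move=> x _; rewrite adde_ge0// lee_fin.
    - apply: filterS rho_le1 => x rx Dx.
      rewrite indicE mem_set// distrC ger0_norm ?subr_ge0//= -EFinD.
      by rewrite subrK.
  rewrite ge0_integralD//; last by move=> x _; rewrite lee_fin.
  by rewrite rho_in => h; rewrite EFinB -h addeK.
have diff_out : (\int[mu]_(x in ~` D) `|rho x - \1_D x|%:E <= (N%:R - s)%:E)%E.
  apply: le_trans rho_out; apply: ge0_le_integral => //.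
  by move=> x Dx; rewrite indicE memNset//= subr0 ger0_norm.
have tail : (t%:E <= s%:E + \int[mu]_(x in ~` D) G x)%E.
  rewrite -evt; apply: lime_le.
    by apply: is_cvg_nneseries => j _ _; rewrite lee_fin; have /andP[] := ev01 j.
  (* Partial sums with n >= N suffice; being at most t <= N, they satisfy the hypothesis of
     [tail_le_spread]. *)
  exists N => // n /= Nn; rewrite big_mkord sumEFin.
  apply: (@le_trans _ _ (s + \sum_(j < n) ev j * (1 - ev j))%:E).
    rewrite lee_fin -lerBlDl; apply: tail_le_spread => //.
    exact: le_trans (sum_le_t n) tN1.
  rewrite EFinD leeD2l// -sumEFin.
  rewrite (eq_bigr (fun j : 'I_n => \int[mu]_(x in ~` D)
     (abs2 (KK (mult_indic D (Phi j)) x))%:E)%E); last first.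
    by move=> j _; rewrite (projected_nrm2_out KK_proj mD spec).
  have mKP j : measurable_fun (~` D) (fun x => (abs2 (KK (mult_indic D (Phi j)) x))%:E).
    apply/measurable_EFinP; apply: measurable_funTS; apply: measurable_abs2.
    by have [] := projection_L2 KK_proj (L2_mult_indic mD (LPhi j)).
  rewrite -ge0_integral_sum//; last by move=> j x _; rewrite lee_fin abs2_ge0.
  apply: ae_ge0_le_integral => //.
  - by move=> x _; apply: sume_ge0 => j _; rewrite lee_fin abs2_ge0.
  - by apply: emeasurable_sum.
  - exact: measurable_funTS.
  - apply: filterS2 (ae_evaluation_set K_repr) KG => x Sx KGx _.
    apply: le_trans KGx; rewrite sumEFin lee_fin.
    have LKx := kernel_L2 KK_proj K_repr Sx.
    have LDK := L2_mult_indic mD LKx.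
    have [_ _ oP _] := spec.
    (* KK P Phi_j(x) = <Phi_j, 1_D K_x>, so Bessel controls all j at once at the point x. *)
    apply: le_trans (orthonormal_bessel n oP LDK); apply: ler_sum => j _.
    rewrite (projection_eval KK_proj K_repr (L2_mult_indic mD (LPhi j)) Sx).
    by rewrite inner_mult_indic (inner_conj LDK (LPhi j)) abs2_conj.
rewrite -(setUv D) ge0_integral_setU//=; last by apply/disj_setPS => x [].
  rewrite diff_in; apply: le_trans (leeD2l _ diff_out) _.
  have IG0 : (0 <= \int[mu]_(x in ~` D) G x)%E by exact: integral_ge0.
  (* (t - s) + (N - s) = (N - t) + 2 (t - s), with N - t < 1 and t - s at most the integral of [G];
     if that integral is infinite the bound is trivial. *)
  move: tail IG0; case: (\int[mu]_(x in ~` D) G x)%E => [r| |]//.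
  - by rewrite -EFinD !lee_fin => ? ?; lra.
  - by move=> _ _; rewrite mulry gtr0_sg// mul1e addey// leey.
Qed.

End spectrogram.

(** * Radial kernels and dilations *)

Section radial.
Context (R : realType) (d : nat).
Local Notation X := 'rV[R]_d.
Local Notation mu := (lebesgue_rV R d).
Local Notation fn := (X -> R[i]).

Lemma euclidean_normN (x : X) : euclidean_norm (- x) = euclidean_norm x.
Proof.
by congr Num.sqrt; apply: eq_bigr => i _; rewrite mxE sqrrN.
Qed.

(** The unit box has measure 1, so the whole space is not null. *)
Lemma ae_lebesgue_rV_ex (P : X -> Prop) : {ae mu, forall x, P x} -> exists x, P x.
Proof.
move=> [N [mN N0 PN]]; apply: contrapT => nP.
have NT : N = setT.
  by apply/seteqP; split => // x _; apply: PN => /= Px; apply: nP; exists x.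
have le01 i : (0 : X) ord0 i <= (const_mx 1 : X) ord0 i by rewrite !mxE.
pose box := [set x : X | forall i,
  (0 : X) ord0 i <= x ord0 i <= (const_mx 1 : X) ord0 i].
have box1 : mu box = _ := lebesgue_rV_box le01.
have : (mu box <= mu N)%E.
  by apply: le_measure; rewrite ?inE ?NT//; exact: measurable_box.
rewrite box1 N0 big1 ?lee_fin ?ler10//.
by move=> i _; rewrite !mxE subr0.
Qed.

Lemma ae_xsection (P : X * X -> Prop) : {ae (mu \x mu)%E, forall z, P z} ->
  {ae mu, forall x, {ae mu, forall y, P (x, y)}}.
Proof.
move=> [N [mN N0 PN]].
have mxN := measurable_fun_xsection mu mN.
have : (\int[mu]_x `|(mu \o xsection N) x| = 0)%E.
  by under eq_integral do rewrite gee0_abs//; exact: N0.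
have [H _] := ae_eq_integral_abs mu measurableT mxN.
move=> /H; apply: filterS => x /= /(_ I) Nx0.
exists (xsection N x); split => //; first exact: measurable_xsection.
by move=> y /= Py; rewrite /xsection/= inE; exact: PN.
Qed.

Variables (L : set fn) (KK : fn -> fn) (K : X -> X -> R[i]) (S0 : set X).
Hypothesis KK_proj : orthogonal_projection mu L KK.
Hypothesis K_repr : reproducing mu S0 L K.
Hypothesis K1 : {ae mu, forall x, K x x = 1}.
Hypothesis K_radial : radial K.

Lemma abs2_kernelC x y : S0 x -> S0 y -> abs2 (K x y) = abs2 (K y x).
Proof.
move=> Sx Sy; have LK z : S0 z -> L (fun y => K y z).
  by move=> Sz; have [_ _ /(_ z Sz)[]] := K_repr.
rewrite (reproducing_eval K_repr (LK _ Sy) Sx) (reproducing_eval K_repr (LK _ Sx) Sy).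
by rewrite (inner_conj (kernel_L2 KK_proj K_repr Sx) (kernel_L2 KK_proj K_repr Sy)) abs2_conj.
Qed.

(** g is the slice of |K|^2 at one good point y0, recentred at 0. Unlike [phi] of the norm it is
    known to be measurable, its mass is K(y0,y0) = 1, and it agrees almost everywhere with the
    recentred slice at almost every other point. *)
Lemma radial_profile : exists g : X -> R,
  [/\ measurable_fun setT g, forall z, 0 <= g z,
      (\int[mu]_z (g z)%:E = 1)%E &
      {ae mu, forall x, {ae mu, forall z, abs2 (K (z + x) x) = g z}}].
Proof.
have [phi _ /ae_xsection Kphi] := K_radial.
have S0_ae := ae_evaluation_set K_repr.
have good : {ae mu, forall x, [/\ S0 x, K x x = 1 &
    {ae mu, forall z, abs2 (K (z + x) x) = phi (euclidean_norm z)}]}.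
  apply: filterS3 (S0_ae) K1 Kphi => x Sx Kx Kxphi; split => //.
  have : {ae mu, forall y, abs2 (K y x) = phi (euclidean_norm (y - x))}.
    apply: filterS2 S0_ae Kxphi => y Sy /= Kxy.
    by rewrite -(abs2_kernelC Sx Sy) Kxy -euclidean_normN opprB.
  move/(ae_translate_rV x); apply: filterS => z ->.
  by rewrite addrK.
have [y0 [Sy0 Ky0 Ky0phi]] := ae_lebesgue_rV_ex good.
have LKy0 := kernel_L2 KK_proj K_repr Sy0.
have mKy0 : measurable_fun setT (fun y => abs2 (K y y0)).
  by have [mK _] := LKy0; exact: measurable_abs2.
exists (fun z => abs2 (K (z + y0) y0)); split.
- exact: measurableT_comp mKy0 (measurable_translate_rV y0).
- by move=> z; exact: abs2_ge0.
- rewrite (ge0_integral_translate_rV y0 (f := fun y => (abs2 (K y y0))%:E)).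
  + by have := L2norm2E LKy0; rewrite (kernel_nrm2 K_repr Sy0) Ky0.
  + exact/measurable_EFinP.
  + by move=> x; rewrite lee_fin abs2_ge0.
- apply: filterS good => x [_ _ Kxphi].
  by apply: filterS2 Kxphi Ky0phi => z -> ->.
Qed.

Section dilation.
Variables (Lam : set X) (Lam_open : open Lam).

Lemma dilateE (r : R) (B : set X) : 0 < r -> dilate r B = [set x | B (r^-1 *: x)].
Proof.
move=> r0; apply/seteqP; split => x /=.
  by move=> [y By <-]; rewrite scalerA mulVf ?gt_eqF// scale1r.
by move=> Bx; exists (r^-1 *: x) => //; rewrite scalerA mulfV ?gt_eqF// scale1r.
Qed.

Lemma measurable_dilate (r : R) (B : set X) : 0 < r -> measurable B ->
  measurable (dilate r B).
Proof.
move=> r0 mB; rewrite dilateE//.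
have := measurable_affine_rV r^-1 (0 : X) measurableT mB; rewrite setTI.
by congr measurable; apply/seteqP; split => x /=; rewrite addr0.
Qed.

Lemma indic_dilate (r : R) (B : set X) x : 0 < r ->
  \1_(dilate r B) x = \1_B (r^-1 *: x) :> R.
Proof.
by move=> r0; rewrite dilateE// !indicE; congr (_%:R); apply/idP/idP; rewrite !inE.
Qed.

(** Here p = (z, u): z is the displacement at the original scale, u a point of the unscaled set. *)
Definition escape (g : X -> R) (r : R) (p : X * X) : \bar R :=
  (g p.1 * (\1_Lam p.2 * \1_(~` Lam) (p.2 - r^-1 *: p.1)))%:E.

Let mLam : measurable Lam := open_measurable_rV Lam_open.

Lemma measurable_indic_comp (dT : measure_display) (T : measurableType dT)
  (B : set X) (f : T -> X) : measurable B -> measurable_fun setT f ->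
  measurable_fun setT (fun x => \1_B (f x) : R).
Proof. by move=> mB mf; apply: measurableT_comp => //; exact: measurable_indic. Qed.

Lemma measurable_shear (a : R) :
  measurable_fun setT (fun p : X * X => p.2 + a *: p.1).
Proof.
apply: measurable_fun_rV => i.
apply: (@eq_measurable_fun _ _ _ _ _ (fun p : X * X => p.2 ord0 i + a * p.1 ord0 i)).
  by move=> p _; rewrite !mxE.
apply: measurable_funD; last apply: measurable_funM => //.
  exact: measurableT_comp (measurable_coord_rV i) (measurable_snd).
exact: measurableT_comp (measurable_coord_rV i) (measurable_fst).
Qed.

Variable g : X -> R.
Hypotheses (mg : measurable_fun setT g) (g0 : forall z, 0 <= g z).

Let mg1 : measurable_fun setT (fun p : X * X => g p.1).
Proof. exact: measurableT_comp mg measurable_fst. Qed.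

Lemma measurable_escape r : measurable_fun setT (escape g r).
Proof.
apply/measurable_EFinP; apply: measurable_funM => //.
apply: measurable_funM.
  by apply: measurable_indic_comp => //; exact: measurable_snd.
apply: measurable_indic_comp; first exact: measurableC.
have := measurable_shear (- r^-1); apply: eq_measurable_fun => p _.
by rewrite scaleNr.
Qed.

Lemma escape_ge0 r p : (0 <= escape g r p)%E.
Proof. by rewrite lee_fin mulr_ge0// mulr_ge0. Qed.

Lemma escape_cvg : (\int[mu]_z (g z)%:E = 1)%E -> (mu Lam < +oo)%E ->
  (\int[mu \x mu]_p escape g r p)%E @[r --> +oo] --> 0%E.
Proof.
(* Dominated convergence concerns sequences, so the limit is tested along every sequence tending to
   +oo. The dominating function g(z) 1_Lam(u) has integral |Lam| because g has mass 1. *)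
move=> g1 Lamoo; apply/cvge_pinftyP => u uoo.
pose dom (p : X * X) : \bar R := (g p.1 * \1_Lam p.2)%:E.
have mdom : measurable_fun setT dom.
  apply/measurable_EFinP; apply: measurable_funM => //.
  by apply: measurable_indic_comp => //; exact: measurable_snd.
have dom0 p : (0 <= dom p)%E by rewrite lee_fin mulr_ge0.
have idom : (mu \x mu)%E.-integrable setT dom.
  apply/integrableP; split => //.
  under eq_integral do rewrite gee0_abs//.
  rewrite fubini_tonelli1//.
  rewrite (_ : (\int[mu]_x _)%E = mu Lam)//.
  rewrite -[RHS]mul1e -g1 -ge0_integralZr//; last 2 first.
  - by apply/measurable_EFinP.
  - by move=> z _; rewrite lee_fin.
  apply: eq_integral => z _; rewrite /fubini_F /dom/=.
  under eq_integral do rewrite EFinM.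
  rewrite ge0_integralZl//; last 2 first.
  - by apply/measurable_EFinP; exact: measurable_indic.
  - by rewrite lee_fin.
  by rewrite (integral_indic mu measurableT mLam) setIT.
have := @dominated_convergence _ _ _ (mu \x mu)%E setT measurableT
  (fun n => escape g (u n)) (cst 0%E) dom.
case => //.
- by move=> n; exact: measurable_escape.
(* At each point the integrand is eventually exactly 0: if x lies in the open set, so does x - z /
   u_n for large n. *)
- apply: aeW => -[z x] _; apply: cvg_near_cst.
  have [Lx|Lx] := pselect (Lam x); last first.
    by apply: nearW => n; rewrite /escape/= indicE memNset//= mul0r mulr0.
  have inv0 : (fun n => (u n)^-1) @ \oo --> (0 : R).
    have u_gt0 : \forall n \near \oo, 0 < u n by move/cvgryPgt : uoo; exact.
    by have [_ /(_ uoo)] := gtr0_cvgV0 u_gt0.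
  have shift : (fun n => x - (u n)^-1 *: z) @ \oo --> x.
    rewrite -[X in _ --> X]subr0 -(scale0r z).
    by apply: cvgB; [exact: cvg_cst|apply: cvgZr_tmp].
  have near_Lam : \forall n \near \oo, Lam (x - (u n)^-1 *: z).
    exact: shift _ (open_nbhs_nbhs (conj Lam_open Lx)).
  apply: filterS near_Lam => n /= Ln.
  by rewrite /escape/= [X in _ * (_ * X)]indicE memNset ?mulr0//=; apply.
- apply: aeW => p n _; rewrite gee0_abs ?escape_ge0// lee_fin.
  rewrite ler_wpM2l// ler_piMr// indicE; by case: (_ \in _).
move=> _ _; rewrite integral0.
exact.
Qed.

End dilation.
End radial.

(** * The mass crossing the boundary of a dilated set *)

Section escape_dilate.
Context (R : realType) (d : nat).
Local Notation X := 'rV[R]_d.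
Local Notation mu := (lebesgue_rV R d).
Variables (Lam : set X) (Lam_open : open Lam) (g : X -> R).
Hypotheses (mg : measurable_fun setT g) (g0 : forall z, 0 <= g z).
Variables (r : R) (r0 : 0 < r).
Local Notation D := (dilate r Lam).

Let mLam : measurable Lam := open_measurable_rV Lam_open.

Let mD : measurable D := measurable_dilate r0 mLam.

(** For almost every x this is |1_D K_x|^2, with |K|^2 replaced by the profile; the integrand is
    jointly measurable in x and z, so it can serve as the majorant [G]. *)
Definition occupation (x : X) : \bar R := (\int[mu]_z (g z * \1_D (z + x)%R)%:E)%E.

Let mg2 : measurable_fun setT (fun p : X * X => g p.2).
Proof. exact: measurableT_comp mg measurable_snd. Qed.

Let m_occ : measurable_fun setT
  (fun p : X * X => (g p.2 * \1_D (p.2 + p.1))%:E).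
Proof.
apply/measurable_EFinP; apply: measurable_funM => //.
apply: measurable_indic_comp => //.
have := @measurable_shear R d 1; apply: eq_measurable_fun => p _.
by rewrite scale1r.
Qed.

Lemma measurable_occupation : measurable_fun setT occupation.
Proof.
apply: (measurable_fun_fubini_tonelli_F (m2 := mu) _ m_occ) => p.
by rewrite lee_fin mulr_ge0.
Qed.

Lemma occupation_ge0 x : (0 <= occupation x)%E.
Proof. by apply: integral_ge0 => z _; rewrite lee_fin mulr_ge0. Qed.

Lemma integral_occupation : ((r^-1 ^+ d)%:E * \int[mu]_(x in ~` D) occupation x =
  \int[mu \x mu]_p escape Lam g r p)%E.
Proof.
have mC : measurable (~` D) by exact: measurableC.
have DC : ~` D = dilate r (~` Lam) by rewrite !dilateE.
pose h (p : X * X) : \bar R := (g p.2 * \1_D (p.2 + p.1)%R * \1_(~` D) p.1)%:E.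
have mh : measurable_fun setT h.
  apply/measurable_EFinP; apply: measurable_funM; first exact/measurable_EFinP.
  by apply: measurable_indic_comp => //; exact: measurable_fst.
have h0 p : (0 <= h p)%E by rewrite lee_fin !mulr_ge0.
have -> : (\int[mu]_(x in ~` D) occupation x = \int[mu]_x \int[mu]_z h (x, z))%E.
  rewrite integral_mkcond; apply: eq_integral => x _; rewrite patchE /h/= indicE.
  case: (x \in ~` D); first by apply: eq_integral => z _; rewrite mulr1.
  by rewrite integral0_eq// => z _; rewrite mulr0.
rewrite fubini_tonelli// fubini_tonelli1//; last 2 first.
- exact: measurable_escape.
- by move=> p; exact: escape_ge0.
rewrite -ge0_integralZl//; last 3 first.
- exact: (measurable_fun_fubini_tonelli_G (m1 := mu) _ mh).
- by move=> z _; exact: integral_ge0.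
- by rewrite lee_fin exprn_ge0// invr_ge0 ltW.
apply: eq_integral => z _.
(* For fixed z, substitute x = r u - z: then z + x = r u lies in D iff u lies in [Lam], and x / r =
   u - z / r. The Jacobian absorbs r^-d. *)
rewrite -(ge0_integral_affine_rV (- z) (f := fun x => h (x, z)) r0)//; last first.
  by apply: measurableT_comp => //; exact: measurable_pair2.
apply: eq_integral => u _; rewrite /h /escape/= addrCA subrr addr0 DC !indic_dilate//.
rewrite scalerDr scalerN !scalerA mulVf ?gt_eqF// !scale1r.
by rewrite mulrA.
Qed.

End escape_dilate.

(** * The rescaled error and its limit *)

Lemma spectrogram_error (R : realType) (d : nat)
  (L : set ('rV[R]_d -> R[i]))
  (KK : ('rV[R]_d -> R[i]) -> ('rV[R]_d -> R[i]))
  (K : 'rV[R]_d -> 'rV[R]_d -> R[i]) (S0 : set 'rV[R]_d)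
  (Lam : set 'rV[R]_d) (g : 'rV[R]_d -> R) (r : R) (rho : 'rV[R]_d -> R) :
  orthogonal_projection (lebesgue_rV R d) L KK ->
  reproducing (lebesgue_rV R d) S0 L K ->
  {ae lebesgue_rV R d, forall x, K x x = 1} ->
  open Lam -> measurable_fun setT g -> (forall z, 0 <= g z) ->
  {ae lebesgue_rV R d, forall x,
    {ae lebesgue_rV R d, forall z, abs2 (K (z + x) x) = g z}} ->
  0 < r -> acc_spectrogram (lebesgue_rV R d) L KK (dilate r Lam) rho ->
  (\int[lebesgue_rV R d]_x `|rho (r *: x) - \1_Lam x|%:E <=
   (r^-1 ^+ d)%:E +
   2%:E * \int[lebesgue_rV R d \x lebesgue_rV R d]_p escape Lam g r p)%E.
Proof.
move=> KK_proj K_repr K1 Lam_open mg g0 Kg r0 rho_spec.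
set mu := lebesgue_rV R d.
have mLam := open_measurable_rV Lam_open.
have mD := measurable_dilate r0 mLam.
have Gx : {ae mu, forall x, (nrm2 mu (mult_indic (dilate r Lam) (fun y => K y x)))%:E <=
    occupation Lam g r x}%E.
  apply: filterS2 (ae_evaluation_set K_repr) Kg => x Sx Kgx.
  have LKx := kernel_L2 KK_proj K_repr Sx; have [mKx _] := LKx.
  rewrite -L2norm2E; last exact: L2_mult_indic.
  have mAbs : measurable_fun setT
      (fun y => (abs2 (mult_indic (dilate r Lam) (fun y => K y x) y))%:E).
    by apply/measurable_EFinP; apply: measurable_abs2; exact: cmeasurable_mult_indic.
  (* Recentring at x turns the slice into [K (z + x) x], whose squared modulus is g(z) for almost
     every z. *)
  rewrite /L2norm2 -(ge0_integral_translate_rV x mAbs); last first.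
    by move=> y; rewrite lee_fin abs2_ge0.
  rewrite le_eqVlt; apply/orP; left; apply/eqP; apply: ge0_ae_eq_integral => //.
  - exact: measurableT_comp mAbs (measurable_translate_rV x).
  - apply/measurable_EFinP; apply: measurable_funM => //.
    by apply: measurable_indic_comp => //; exact: measurable_translate_rV.
  - by move=> y _; rewrite lee_fin abs2_ge0.
  - by move=> y _; rewrite lee_fin mulr_ge0.
  - apply: filterS Kgx => z Kz _; rewrite /mult_indic abs2M Kz mulrC; congr (_ * _)%:E.
    rewrite !indicE; case: (_ \in _); rewrite /abs2/=; first by rewrite expr1n expr0n addr0.
    by rewrite expr0n addr0.
have [mrho bound] := acc_spectrogram_bound KK_proj K_repr K1 mD
  (measurable_occupation Lam_open mg g0 r0) (occupation_ge0 _ g0 _) Gx rho_spec.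
pose f y : \bar R := `|rho y - \1_(dilate r Lam) y|%:E.
have mf : measurable_fun setT f.
  apply/measurable_EFinP; apply: measurableT_comp => //.
  by apply: measurable_funB => //; exact: measurable_indic.
have f0 y : (0 <= f y)%E by rewrite lee_fin.
have -> : (\int[mu]_x `|rho (r *: x) - \1_Lam x|%:E =
    (r^-1 ^+ d)%:E * \int[mu]_x f x)%E.
  rewrite -(ge0_integral_affine_rV 0 r0 mf f0); apply: eq_integral => x _.
  by rewrite /f addr0 indic_dilate// scalerA mulVf ?gt_eqF// scale1r.
have c0 : (0 <= (r^-1 ^+ d)%:E)%E by rewrite lee_fin exprn_ge0// invr_ge0 ltW.
apply: (le_trans (lee_wpmul2l c0 bound)).
rewrite ge0_muleDr//; last by rewrite mule_ge0// integral_ge0// => x _; exact: occupation_ge0.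
by rewrite mule1 muleCA integral_occupation.
Qed.

Theorem corollary1p4 (R : realType) (d : nat) (d_gt0 : (0 < d)%N)
  (L : set ('rV[R]_d -> R[i]))
  (KK : ('rV[R]_d -> R[i]) -> ('rV[R]_d -> R[i]))
  (K : 'rV[R]_d -> 'rV[R]_d -> R[i]) (S0 : set 'rV[R]_d)
  (KK_proj : orthogonal_projection (lebesgue_rV R d) L KK)
  (KK_ltc : locally_trace_class KK)
  (KK_kernel : integral_kernel (lebesgue_rV R d) KK K)
  (K_repr : reproducing (lebesgue_rV R d) S0 L K)
  (dO : measure_display) (Om : measurableType dO) (P : probability Om R)
  (xi : Om -> set 'rV[R]_d)
  (xi_dpp : determinantal_process P xi K)
  (K_radial : radial K)
  (K_diag : {ae lebesgue_rV R d, forall x, K x x = 1})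
  (Lam : set 'rV[R]_d) (Lam_open : open Lam)
  (Lam_relcompact : compact (closure Lam))
  (rho : R -> 'rV[R]_d -> R)
  (rho_spec : forall r : R, 0 < r ->
     acc_spectrogram (lebesgue_rV R d) L KK (dilate r Lam) (rho r)) :
  (\int[lebesgue_rV R d]_x `|rho r (r *: x) - \1_Lam x|%:E)%E @[r --> +oo]
    --> 0%E.
Proof.
have [g [mg g0 g1 Kg]] := radial_profile KK_proj K_repr K_diag K_radial.
have mLam := open_measurable_rV Lam_open.
have Lam_fin : (lebesgue_rV R d Lam < +oo)%E.
  apply: bounded_lebesgue_rV_lty => //.
  have [M [M_real HM]] := compact_bounded Lam_relcompact.
  by exists M; split => // c Mc x Lx; apply: HM Mc _ _; exact: subset_closure.
have invd : (r^-1 ^+ d)%:E @[r --> (+oo : set_system R)] --> 0%E.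
  apply: cvg_EFin; first exact: nearW.
  have r_gt0 : \forall r \near (+oo : set_system R), 0 < r by exact: nbhs_pinfty_gt.
  have inv0 : r^-1 @[r --> (+oo : set_system R)] --> (0 : R).
    by have [_ /(_ (@cvg_id _ _))] := gtr0_cvgV0 r_gt0.
  (* Here d >= 1 enters: 0 ^ d would be 1 for d = 0, and the rounding error would persist. *)
  rewrite -[X in _ --> X](_ : (0 : R) ^+ d = 0); last by rewrite expr0n gtn_eqF.
  apply: (@continuous_cvg _ R R _ _ (fun r : R => r^-1) (fun x : R => x ^+ d) 0) => //.
  exact: exprn_continuous.
apply: (@squeeze_cvge _ _ _ _ (cst 0%E) _ (fun r => (r^-1 ^+ d)%:E +
   2%:E * \int[lebesgue_rV R d \x lebesgue_rV R d]_p escape Lam g r p)%E).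
- near=> r.
  have r0 : 0 < r by near: r; exact: nbhs_pinfty_gt.
  apply/andP; split; first by apply: integral_ge0 => x _; rewrite lee_fin.
  exact: (spectrogram_error KK_proj K_repr K_diag Lam_open mg g0 Kg r0 (rho_spec r r0)).
- exact: cvg_cst.
- rewrite -[X in _ --> X]adde0 -[X in (_ + X)%E](mule0 2%:E).
  apply: cvgeD => //; apply: cvgeZl => //.
  exact: escape_cvg.
Unshelve. all: by end_near.
Qed.
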